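(* Let $M$ be a complete, properly immersed minimal surface in $\mathbb{R}^3$. If $M$ is not flat (that is, its Gauss curvature is not identically zero), then $M$ is not contained in any halfspace of $\mathbb{R}^3$.
   Context: A minimal surface is a connected smooth surface $M$ without boundary together with a smooth minimal immersion into $\mathbb{R}^3$, with the induced Riemannian metric. ''Complete'' means geodesically complete. ''Properly immersed'' means that the immersion is a proper map. ''Contained in a halfspace'' means that the image of the immersion is contained in it. *)

(* Defs.v *)
From HB Require Import structures.
From mathcomp Require Import all_boot all_order all_algebra.
From mathcomp Require Import all_classical all_reals all_analysis.

Set Implicit Arguments.
Unset Strict Implicit.
Unset Printing Implicit Defensive.

Import Order.TTheory GRing.Theory Num.Theory.
Import numFieldNormedType.Exports.

Local Open Scope classical_set_scope.
Local Open Scope ring_scope.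

Section Calculus.
Context {R : realType}.

Definition partial n (W : normedModType R) (i : 'I_n) (F : 'rV[R]_n -> W)
  : 'rV[R]_n -> W := fun x => 'D_(delta_mx 0 i) F x.

(* C^oo on an open set U: every iterated partial derivative of F exists and is
   differentiable at every point of U. *)
Definition smooth_on n (W : normedModType R) (U : set 'rV[R]_n)
    (F : 'rV[R]_n -> W) : Prop :=
  forall s : seq 'I_n, forall x, U x ->
    differentiable (foldr (@partial n W) F s) x.

Definition dot n (u v : 'rV[R]_n) : R := (u *m v^T) 0 0.

(* Indices are added modulo 3. *)
Definition cross (u v : 'rV[R]_3) : 'rV[R]_3 :=
  \row_k (u 0 (k + 1) * v 0 (k + 2%:R) - u 0 (k + 2%:R) * v 0 (k + 1)).

End Calculus.

Section LocalGeometry.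
Context {R : realType}.
Variable X : 'rV[R]_2 -> 'rV[R]_3.

Definition first_form (x : 'rV[R]_2) : 'M[R]_2 :=
  \matrix_(i, j) dot (partial i X x) (partial j X x).

Definition unit_normal (x : 'rV[R]_2) : 'rV[R]_3 :=
  let n := cross (partial 0 X x) (partial 1 X x) in
  (Num.sqrt (dot n n))^-1 *: n.

Definition second_form (x : 'rV[R]_2) : 'M[R]_2 :=
  \matrix_(i, j) dot (partial i (partial j X) x) (unit_normal x).

Definition shape_operator (x : 'rV[R]_2) : 'M[R]_2 :=
  invmx (first_form x) *m second_form x.

Definition mean_curvature (x : 'rV[R]_2) : R := \tr (shape_operator x) / 2.

Definition gauss_curvature (x : 'rV[R]_2) : R := \det (shape_operator x).

(* christoffel k i j is the symbol with upper index k and lower indices i, j of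
   the Levi-Civita connection of the induced metric. *)
Definition christoffel (k i j : 'I_2) (x : 'rV[R]_2) : R :=
  let dg (a b c : 'I_2) : R := partial a (fun y => first_form y b c) x in
  2^-1 * \sum_l invmx (first_form x) k l * (dg i j l + dg j i l - dg l i j).

Definition geodesic_equation (u : R -> 'rV[R]_2) (t : R) : Prop :=
  forall k : 'I_2,
    derive1n 2 u t 0 k + \sum_i \sum_j
      christoffel k i j (u t) * derive1 u t 0 i * derive1 u t 0 j = 0.

End LocalGeometry.

(* chart_map and chart_inv are meaningful only on chart_dom and on its image
   respectively. *)
Record chart (R : realType) (M : topologicalType) := Chart {
  chart_dom : set M ;
  chart_map : M -> 'rV[R]_2 ;
  chart_inv : 'rV[R]_2 -> M ;
  chart_dom_open : open chart_dom ;
  chart_codom_open : open (chart_map @` chart_dom) ;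
  chart_mapK : forall p, chart_dom p -> chart_inv (chart_map p) = p ;
  chart_map_continuous : forall p, chart_dom p -> {for p, continuous chart_map} ;
  chart_inv_continuous : forall x, (chart_map @` chart_dom) x ->
    {for x, continuous chart_inv}
}.

Definition chart_codom R M (c : @chart R M) : set 'rV[R]_2 :=
  chart_map c @` chart_dom c.

(* The atlas need not be maximal. Connectedness is not part of the record. *)
Record smooth_surface (R : realType) := SmoothSurface {
  surface_space :> topologicalType ;
  surface_hausdorff : hausdorff_space surface_space ;
  surface_second_countable : @second_countable surface_space ;
  atlas : set (chart R surface_space) ;
  atlas_cover : forall p, exists2 c, atlas c & chart_dom c p ;
  atlas_compatible : forall c c', atlas c -> atlas c' ->
    smooth_on (chart_map c @` (chart_dom c `&` chart_dom c'))
              (chart_map c' \o chart_inv c)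
}.

Section ImmersedSurfaces.
Context {R : realType}.
Variables (M : smooth_surface R) (f : M -> 'rV[R]_3).

Definition local_param (c : chart R M) : 'rV[R]_2 -> 'rV[R]_3 :=
  f \o chart_inv c.

Definition smooth_immersion : Prop :=
  forall c, atlas c ->
    smooth_on (chart_codom c) (local_param c) /\
    forall x, chart_codom c x -> injective ('d (local_param c) x).

Definition minimal_immersion : Prop :=
  smooth_immersion /\
  forall c, atlas c -> forall x, chart_codom c x ->
    mean_curvature (local_param c) x = 0.

Definition flat_surface : Prop :=
  forall c, atlas c -> forall x, chart_codom c x ->
    gauss_curvature (local_param c) x = 0.

(* J is meant to be an open interval; geodesics are affinely parametrized and
   may be constant. *)
Definition geodesic_on (J : set R) (gamma : R -> M) : Prop :=
  (forall t, J t -> {for t, continuous gamma}) /\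
  forall c, atlas c -> forall t, J t -> chart_dom c (gamma t) ->
    let u := chart_map c \o gamma in
    (forall n, derivable (derive1n n u) t 1) /\
    geodesic_equation (local_param c) u t.

Definition geodesically_complete : Prop :=
  forall (J : set R) (gamma : R -> M),
    open J -> is_interval J -> J !=set0 -> geodesic_on J gamma ->
    exists gamma' : R -> M,
      geodesic_on [set: R] gamma' /\ forall t, J t -> gamma' t = gamma t.

Definition proper_immersion : Prop :=
  smooth_immersion /\ forall K, compact K -> compact (f @^-1` K).

End ImmersedSurfaces.

Definition halfspace (R : realType) (H : set 'rV[R]_3) : Prop :=
  exists (v : 'rV[R]_3) (b : R), v != 0 /\
    (H = [set x | b <= dot v x] \/ H = [set x | b < dot v x]).

(* Main.v *)
Require Import Defs.
From mathcomp Require Import all_boot all_order all_algebra.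
From mathcomp Require Import all_classical all_reals all_analysis.
From mathcomp Require Import ring lra.

(** The halfspace theorem of Hoffman and Meeks, by maximum principles instead
    of a comparison with catenoids.

    Let [v3] be the unit normal of the halfspace and call the coordinate along
    it the height. Everything rests on one fact ([local_min_minimal]): if a function
    [phi] on space, restricted to a minimal surface, has a local minimum, then its
    gradient there is normal to the surface and the trace of its Hessian over
    the tangent plane is nonnegative; the second derivatives of the immersion
    enter only through the mean curvature. So two explicit functions whose Hessian
    has negative trace on any plane orthogonal to their gradient have no
    interior minima on minimal surfaces.

    First, the height attains its infimum [m] ([height_min_attained]). Let
    [w] be the squared distance to the vertical axis. Where [w >= 1] the function
    [ln w - 2 height^2] is superharmonic on every minimal surface, and strictly so
    where the surface is not horizontal ([log_barrier_trace]); it tends to infinity on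
    the slab, and by properness a small multiple of it added to the height
    has a minimum over the part of the surface in the slab outside the cylinder
    [w = 1]. This shows that the height in the slab is bounded below by its values
    on the boundary of that part, and the part inside the cylinder is compact.

    Second, the set of lowest points is open ([lowest_points_open]), which is
    Hopf's strong maximum principle. At a lowest point the tangent plane is
    horizontal, so that the horizontal projection is injective near it
    ([horizontal_locally_injective]). If lowest points had non-lowest points
    arbitrarily close by, a horizontal disc around one of the latter would touch
    the set of lowest points from outside; a quadratic barrier at the point of
    contact excludes this ([no_interior_contact], [disc_barrier_trace]). The
    barrier is a polynomial in the ambient coordinates, and the tangent plane at a
    critical point is read off from the gradient of the perturbed height, so no estimates
    on the metric in the chart are involved.

    By connectedness the height is constant, hence the normal is constant and
    the second fundamental form vanishes ([planar_gauss_curvature]). *)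

Set Implicit Arguments.
Unset Strict Implicit.
Unset Printing Implicit Defensive.

Import Order.TTheory GRing.Theory Num.Theory.
Import numFieldNormedType.Exports.

Local Open Scope classical_set_scope.
Local Open Scope ring_scope.

(** * Linear algebra of the dot product *)

Lemma sum_ord2 (V : nmodType) (F : 'I_2 -> V) : \sum_i F i = F 0 + F 1.
Proof.
rewrite !big_ord_recl big_ord0 addr0.
by have -> : lift ord0 ord0 = 1 :> 'I_2 by apply/val_inj.
Qed.

Lemma cramer2 (F : fieldType) (a b c e p q : F) : a * e - b * c != 0 ->
  p * a + q * b = 0 -> p * c + q * e = 0 -> p = 0 /\ q = 0.
Proof.
move=> D0 h1 h2; split; apply: (mulfI D0); rewrite mulr0.
  transitivity (e * (p * a + q * b) - b * (p * c + q * e)); first by ring.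
  by rewrite h1 h2 !mulr0 subrr.
transitivity (a * (p * c + q * e) - c * (p * a + q * b)); first by ring.
by rewrite h1 h2 !mulr0 subrr.
Qed.

Section DotProduct.
Context {R : realType}.

Lemma dotE n (u v : 'rV[R]_n) : dot u v = \sum_i u 0 i * v 0 i.
Proof. by rewrite /dot mxE; apply: eq_bigr => i _; rewrite mxE. Qed.

Lemma dotC n (u v : 'rV[R]_n) : dot u v = dot v u.
Proof. by rewrite !dotE; apply: eq_bigr => i _; rewrite mulrC. Qed.

Lemma dotDl n (u u' v : 'rV[R]_n) : dot (u + u') v = dot u v + dot u' v.
Proof. by rewrite /dot mulmxDl mxE. Qed.

Lemma dotZl n a (u v : 'rV[R]_n) : dot (a *: u) v = a * dot u v.
Proof. by rewrite /dot -scalemxAl mxE. Qed.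

Lemma dotDr n (u v v' : 'rV[R]_n) : dot u (v + v') = dot u v + dot u v'.
Proof. by rewrite dotC dotDl !(dotC u). Qed.

Lemma dotZr n a (u v : 'rV[R]_n) : dot u (a *: v) = a * dot u v.
Proof. by rewrite dotC dotZl dotC. Qed.

Lemma dotNl n (u v : 'rV[R]_n) : dot (- u) v = - dot u v.
Proof. by rewrite -scaleN1r dotZl mulN1r. Qed.

Lemma dotNr n (u v : 'rV[R]_n) : dot u (- v) = - dot u v.
Proof. by rewrite dotC dotNl dotC. Qed.

Lemma dot0l n (u : 'rV[R]_n) : dot 0 u = 0.
Proof. by rewrite /dot mul0mx mxE. Qed.

Lemma dot0r n (u : 'rV[R]_n) : dot u 0 = 0.
Proof. by rewrite dotC dot0l. Qed.

Lemma dot_suml n (I : Type) (r : seq I) P (F : I -> 'rV[R]_n) v :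
  dot (\sum_(i <- r | P i) F i) v = \sum_(i <- r | P i) dot (F i) v.
Proof. by elim/big_rec2: _ => [|i a b _ <-]; rewrite ?dot0l ?dotDl. Qed.

Definition dot_lin := (dotDl, dotDr, dotZl, dotZr, dotNl, dotNr).

Lemma dot_ge0 n (u : 'rV[R]_n) : 0 <= dot u u.
Proof. by rewrite dotE; apply: sumr_ge0 => i _; rewrite -expr2 sqr_ge0. Qed.

Lemma dot_gt0 n (u : 'rV[R]_n) : u != 0 -> 0 < dot u u.
Proof.
move=> u0; rewrite lt_def dot_ge0 andbT; apply: contra u0 => /eqP.
rewrite dotE => /eqP; rewrite psumr_eq0 => [/allP h|i _]; last by rewrite -expr2 sqr_ge0.
apply/eqP/rowP => i; rewrite mxE; apply/eqP; rewrite -sqrf_eq0 expr2.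
by apply: h; rewrite mem_index_enum.
Qed.

Lemma dot3E (u v : 'rV[R]_3) :
  dot u v = u 0 0 * v 0 0 + u 0 1 * v 0 1 + u 0 2%:R * v 0 2%:R.
Proof.
rewrite dotE !big_ord_recl big_ord0 addr0 addrA.
have -> : lift ord0 ord0 = 1 :> 'I_3 by apply/val_inj.
by have -> : lift ord0 (lift ord0 ord0) = 2%:R :> 'I_3 by apply/val_inj.
Qed.

Lemma crossE (u v : 'rV[R]_3) :
  [/\ cross u v 0 0 = u 0 1 * v 0 2%:R - u 0 2%:R * v 0 1,
      cross u v 0 1 = u 0 2%:R * v 0 0 - u 0 0 * v 0 2%:R &
      cross u v 0 2%:R = u 0 0 * v 0 1 - u 0 1 * v 0 0].
Proof.
have e1 : 0 + 1 = 1 :> 'I_3 by apply/val_inj.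
have e2 : 0 + 2%:R = 2%:R :> 'I_3 by apply/val_inj.
have e3 : 1 + 1 = 2%:R :> 'I_3 by apply/val_inj.
have e4 : 1 + 2%:R = 0 :> 'I_3 by apply/val_inj.
have e5 : 2%:R + 1 = 0 :> 'I_3 by apply/val_inj.
have e6 : 2%:R + 2%:R = 1 :> 'I_3 by apply/val_inj.
by split; rewrite mxE ?e1 ?e2 ?e3 ?e4 ?e5 ?e6.
Qed.

Lemma dot_crossl (u v : 'rV[R]_3) : dot u (cross u v) = 0.
Proof. by have [c0 c1 c2] := crossE u v; rewrite dot3E c0 c1 c2; ring. Qed.

Lemma dot_crossr (u v : 'rV[R]_3) : dot v (cross u v) = 0.
Proof. by have [c0 c1 c2] := crossE u v; rewrite dot3E c0 c1 c2; ring. Qed.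

Lemma dot_cross_cross (u v : 'rV[R]_3) :
  dot (cross u v) (cross u v) = dot u u * dot v v - dot u v ^+ 2.
Proof. by have [c0 c1 c2] := crossE u v; rewrite !dot3E c0 c1 c2; ring. Qed.

Definition orthonormal (e1 e2 e3 : 'rV[R]_3) : Prop :=
  [/\ dot e1 e1 = 1, dot e2 e2 = 1 & dot e3 e3 = 1] /\
  [/\ dot e1 e2 = 0, dot e1 e3 = 0 & dot e2 e3 = 0].

(** A square matrix with orthonormal rows has orthonormal columns. *)
Lemma parseval (e1 e2 e3 x y : 'rV[R]_3) : orthonormal e1 e2 e3 ->
  dot x y = dot x e1 * dot y e1 + dot x e2 * dot y e2 + dot x e3 * dot y e3.
Proof.
move=> [[e11 e22 e33] [e12 e13 e23]].
pose e := fun i : 'I_3 => if i == 0 then e1 else if i == 1 then e2 else e3.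
pose P : 'M[R]_3 := \matrix_i e i.
have PPt : P *m P^T = 1%:M.
  apply/matrixP => i j; have -> : (P *m P^T) i j = dot (e i) (e j).
    by rewrite /dot !mxE; apply: eq_bigr => k _; rewrite !mxE.
  case: i => -[|[|[|//]]] hi; case: j => -[|[|[|//]]] hj; rewrite !mxE /e /=;
    by rewrite ?(dotC e2 e1) ?(dotC e3).
have PtP := mulmx1C PPt.
have -> : dot x y = dot (x *m P^T) (y *m P^T).
  by rewrite /dot trmx_mul trmxK mulmxA -(mulmxA x) PtP mulmx1.
have h z i : (z *m P^T) 0 i = dot z (e i).
  by rewrite /dot !mxE; apply: eq_bigr => k _; rewrite !mxE.
by rewrite dot3E !h.
Qed.

Lemma orthonormal_cross (v e : 'rV[R]_3) :
  dot v v = 1 -> dot e e = 1 -> dot e v = 0 -> orthonormal e (cross v e) v.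
Proof.
move=> vv ee ev; split; split => //; rewrite ?dot_crossr //.
- by rewrite dot_cross_cross (dotC v) vv ee ev; ring.
- by rewrite dotC dot_crossl.
Qed.

Definition independent (u w : 'rV[R]_3) : Prop :=
  forall p q, p *: u + q *: w = 0 -> p = 0 /\ q = 0.

Lemma independent_gt0 u w : independent u w -> 0 < dot u u.
Proof.
move=> ind; apply: dot_gt0; apply/eqP => h.
have /ind[/eqP] : 1 *: u + 0 *: w = 0 by rewrite h scaler0 scale0r addr0.
by rewrite oner_eq0.
Qed.

(** By the Lagrange identity the square norm of the cross product is the Gram
    determinant, which up to the positive factor [dot u u] is the square norm of
    a nontrivial combination of [u] and [w]. *)
Lemma cross_gt0 u w : independent u w -> 0 < dot (cross u w) (cross u w).
Proof.
move=> ind; have u0 := independent_gt0 ind.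
rewrite dot_cross_cross -(pmulr_rgt0 _ u0).
have -> : dot u u * (dot u u * dot w w - dot u w ^+ 2) =
    dot (- dot u w *: u + dot u u *: w) (- dot u w *: u + dot u u *: w).
  by rewrite !dot_lin (dotC w u); ring.
apply: dot_gt0; apply/eqP => /ind[_ /eqP].
by rewrite gt_eqF.
Qed.

Lemma gram_schmidt u w n : independent u w ->
  dot n n = 1 -> dot u n = 0 -> dot w n = 0 ->
  exists p q r, orthonormal (p *: u) (q *: u + r *: w) n.
Proof.
move=> ind nn un wn; have u0 := independent_gt0 ind.
have suu : Num.sqrt (dot u u) ^+ 2 = dot u u by rewrite sqr_sqrtr // ltW.
pose z := - (dot u w / dot u u) *: u + 1 *: w.
have z0 : 0 < dot z z.
  by apply: dot_gt0; apply/eqP => /ind[_ /eqP]; rewrite oner_eq0.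
have szz : Num.sqrt (dot z z) ^+ 2 = dot z z by rewrite sqr_sqrtr // ltW.
have zn : dot z n = 0 by rewrite !dot_lin un wn !mulr0 addr0.
have uz : dot u z = 0.
  by rewrite !dot_lin mulNr divfK ?gt_eqF // mul1r addNr.
exists (Num.sqrt (dot u u))^-1, (- (Num.sqrt (dot z z))^-1 * (dot u w / dot u u)).
exists (Num.sqrt (dot z z))^-1.
have -> : - (Num.sqrt (dot z z))^-1 * (dot u w / dot u u) *: u +
    (Num.sqrt (dot z z))^-1 *: w = (Num.sqrt (dot z z))^-1 *: z.
  by rewrite scalerDr !scalerA mulr1 mulrN mulNr.
split; split; rewrite // ?dotZl ?dotZr ?un ?zn ?uz ?mulr0 //.
- by rewrite mulrA -invfM -expr2 suu mulVf // gt_eqF.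
- by rewrite mulrA -invfM -expr2 szz mulVf // gt_eqF.
Qed.

(** Both [n] and [v] span the normal line of the plane of [u] and [w]. *)
Lemma dot_common_normal u w n v x : independent u w ->
  dot n n = 1 -> dot u n = 0 -> dot w n = 0 ->
  dot v v = 1 -> dot v u = 0 -> dot v w = 0 -> dot x v = 0 -> dot x n = 0.
Proof.
move=> ind nn un wn vv vu vw xv; have [p [q [r eO]]] := gram_schmidt ind nn un wn.
have ve y : dot y v = dot y n * dot v n.
  by rewrite (parseval _ _ eO) !dotDr !dotZr vu vw !mulr0 addr0 mulr0 !add0r.
have vn : dot v n != 0.
  by apply/eqP => vn; have := oner_eq0 R; rewrite -vv ve vn mulr0 eqxx.
by apply: (mulIf vn); rewrite -ve xv mul0r.
Qed.

End DotProduct.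

(** * Second-order calculus along curves *)

Section SecondOrderCalculus.
Context {R : realType}.

Lemma is_derive_dot (V : normedModType R) n (F : V -> 'rV[R]_n) x w l v :
  is_derive x w F l -> is_derive x w (fun y => dot v (F y)) (dot v l).
Proof.
move=> [dF <-].
have -> : (fun y => dot v (F y)) = \sum_i (v 0 i *: (fun y => F y 0 i)).
  by apply/funext => y; rewrite dotE fct_sumE.
have dFi i : is_derive x w (fun y => F y 0 i) ('D_w F x 0 i).
  have dFi := (derivable_mxP F x w).1 dF 0 i.
  by rewrite derive_mx // mxE; apply: derivableP.
by apply: is_derive_eq; rewrite dotE.
Qed.

Lemma is_derive_line (V W : normedModType R) (F : V -> W) x a (t : R) :
  differentiable F (x + t *: a) ->
  is_derive t 1 (fun s : R => F (x + s *: a)) ('D_a F (x + t *: a)).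
Proof.
move=> /(@diff_derivable _ _ _ _ _ a) dF; rewrite /derivable in dF.
have E : (fun h : R => h^-1 *: (((fun s : R => F (x + s *: a)) \o shift t) (h *: 1) -
    (fun s : R => F (x + s *: a)) t)) =
    (fun h => h^-1 *: ((F \o shift (x + t *: a)) (h *: a) - F (x + t *: a))).
  apply/funext => h /=; congr (_ *: (F _ - _)).
  by rewrite [h%:A]mulr1 scalerDl addrCA.
apply: DeriveDef; first by rewrite /derivable E.
by rewrite /derive E.
Qed.

(** First- and second-derivative tests in one variable; if the second
    derivative were negative, the first one would be negative on the right
    of 0 and the function would drop below its minimum. *)
Lemma second_derivative_test (G G1 : R -> R) (g2 : R) :
  (\forall t \near (0 : R), is_derive (t : R) 1 G (G1 t)) -> is_derive (0 : R) 1 G1 g2 ->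
  (\forall t \near (0 : R), G 0 <= G t) -> G1 0 = 0 /\ 0 <= g2.
Proof.
move=> dG [dG1 g2E] mG.
have /nbhs_ballP[d /= d0 hd] :
  \forall t \near (0 : R), is_derive (t : R) 1 G (G1 t) /\ G 0 <= G t.
  exact: filterI.
have hd' (t : R) : `|t| < d -> is_derive t 1 G (G1 t) /\ G 0 <= G t.
  by move=> td; apply: hd; rewrite /ball /= sub0r normrN.
have hdi (t : R) : t \in `](- d), d[%R -> is_derive t 1 G (G1 t) /\ G 0 <= G t.
  by rewrite in_itv /= -ltr_norml; exact: hd'.
have G10 : G1 0 = 0.
  have dd : - d <= d by lra.
  have d00 : 0 \in `](- d), d[%R by rewrite in_itv /= oppr_lt0 d0.
  have der t : t \in `](- d), d[%R -> derivable G t 1 by move=> /hdi[[]].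
  have [_ E0] := derive1_at_min dd der d00 (fun t td => (hdi t td).2).
  by have [[_ E1] _] := hdi 0 d00; rewrite -E1.
split=> //; rewrite leNgt; apply/negP => g2N.
have : (h^-1 *: ((G1 \o shift 0) (h *: 1) - G1 0)) @[h --> 0^'] --> g2.
  by rewrite -g2E; exact: dG1.
move=> /cvgrPdist_lt /(_ (- g2)); rewrite oppr_gt0 => /(_ g2N).
move=> [r /= r0 hr].
pose b := Num.min d r / 2.
have m0 : 0 < Num.min d r by rewrite lt_min d0 r0.
have b0 : 0 < b by rewrite divr_gt0.
have bd : b < Num.min d r by rewrite ltr_pdivrMr // ltr_pMr // ltr1n.
have [bd' br] : b < d /\ b < r by move: bd; rewrite lt_min => /andP[].
have G1N (t : R) : 0 < t -> t <= b -> G1 t < 0.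
  move=> t0 tb; have := hr t; rewrite /= sub0r normrN gtr0_norm // (le_lt_trans tb) //.
  move=> /(_ isT); rewrite gt_eqF // => /(_ isT).
  rewrite addr0 [_%:A]mulr1 G10 subr0 => /ltr_normlP[+ _].
  by rewrite opprB ltrBlDr addNr [_ *: _]mulrC pmulr_llt0 ?invr_gt0.
have bd2 c : 0 <= c -> c <= b -> `|c| < d.
  by move=> c0 cb; rewrite ger0_norm // (le_lt_trans cb).
have [c|c|c] := @MVT _ G G1 0 b b0.
- by rewrite in_itv /= => /andP[/ltW c0 /ltW cb]; have [] := hd' c (bd2 c c0 cb).
- apply: derivable_within_continuous => t; rewrite in_itv /= => /andP[t0 tb].
  by have [[]] := hd' t (bd2 t t0 tb).
- rewrite in_itv /= subr0 => /andP[c0 cb] E.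
  have := (hd' b (bd2 b (ltW b0) (lexx _))).2; rewrite -subr_ge0 E leNgt.
  by rewrite pmulr_llt0 // G1N // ltW.
Qed.

Definition C2curve (g g1 : R -> 'rV[R]_3) (g2 : 'rV[R]_3) : Prop :=
  (\forall t \near (0 : R), is_derive (t : R) 1 g (g1 t)) /\ is_derive (0 : R) 1 g1 g2.

(** [nu] is the gradient of [phi] at [p] and [H] its Hessian quadratic form,
    expressed through what they are for: the second-order chain rule along
    curves through [p].  In this form sums, products and logarithms follow from
    the one-variable rules. *)
Definition jet2 (phi : 'rV[R]_3 -> R) (p nu : 'rV[R]_3) (H : 'rV[R]_3 -> R) : Prop :=
  forall g g1 g2, C2curve g g1 g2 -> g 0 = p ->
  exists2 G1 : R -> R, (\forall t \near (0 : R), is_derive (t : R) 1 (phi \o g) (G1 t)) &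
    G1 0 = dot nu (g1 0) /\ is_derive (0 : R) 1 G1 (H (g1 0) + dot nu g2).

Lemma jet2_eq phi p nu mu H K : jet2 phi p nu H -> nu = mu -> H =1 K -> jet2 phi p mu K.
Proof. by move=> + <- /funext <-. Qed.

Lemma jet2_cst c p : jet2 (fun=> c) p 0 (fun=> 0).
Proof.
move=> g g1 g2 _ _; exists (cst 0).
  by near=> t; exact: (is_derive_cst (c : R) (t : R) (1 : R)).
by rewrite !dot0l addr0; split=> //; exact: is_derive_cst.
Unshelve. all: by end_near. Qed.

Lemma jet2_dot v p : jet2 (dot v) p v (fun=> 0).
Proof.
move=> g g1 g2 [dg dg1] _; exists (dot v \o g1) => //=.
  by apply: filterS dg => t; exact: is_derive_dot.
by split=> //; rewrite add0r; apply: is_derive_dot.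
Qed.

Lemma jet2D phi psi p nu mu H K : jet2 phi p nu H -> jet2 psi p mu K ->
  jet2 (fun x => phi x + psi x) p (nu + mu) (fun e => H e + K e).
Proof.
move=> jH jK g g1 g2 cg gp.
have [F1 dF [F10 dF1]] := jH _ _ _ cg gp; have [G1 dG [G10 dG1]] := jK _ _ _ cg gp.
exists (F1 + G1); last split.
- near=> t; have dFt : is_derive t 1 (phi \o g) (F1 t) by near: t.
  have dGt : is_derive t 1 (psi \o g) (G1 t) by near: t.
  exact: (is_deriveD dFt dGt).
- by rewrite /= dotDl -F10 -G10.
- by apply: is_derive_eq; rewrite dotDl addrACA.
Unshelve. all: by end_near. Qed.

Lemma jet2M phi psi p nu mu H K : jet2 phi p nu H -> jet2 psi p mu K ->
  jet2 (fun x => phi x * psi x) p (phi p *: mu + psi p *: nu)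
    (fun e => phi p * K e + psi p * H e + 2 * dot nu e * dot mu e).
Proof.
move=> jH jK g g1 g2 cg gp.
have [F1 dF [F10 dF1]] := jH _ _ _ cg gp; have [G1 dG [G10 dG1]] := jK _ _ _ cg gp.
exists (fun t => phi (g t) * G1 t + psi (g t) * F1 t); last split.
- near=> t; have dFt : is_derive t 1 (phi \o g) (F1 t) by near: t.
  have dGt : is_derive t 1 (psi \o g) (G1 t) by near: t.
  exact: (is_deriveM dFt dGt).
- by rewrite /= gp dotDl !dotZl -F10 -G10.
- have dF0 := nbhs_singleton dF; have dG0 := nbhs_singleton dG.
  have := is_deriveD (is_deriveM dF0 dG1) (is_deriveM dG0 dF1).
  move=> h; apply: (is_derive_eq h).
  rewrite /= gp F10 G10 /GRing.scale /= !dot_lin; ring.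
Unshelve. all: by end_near. Qed.

Lemma jet2Z c phi p nu H : jet2 phi p nu H ->
  jet2 (fun x => c * phi x) p (c *: nu) (fun e => c * H e).
Proof.
move=> /(jet2M (@jet2_cst c p)) j g g1 g2 cg gp.
have [G1 dG [G10 dG1]] := j _ _ _ cg gp; exists G1 => //; split.
  by rewrite G10 scaler0 addr0.
by apply: (is_derive_eq dG1); rewrite dot0l !(mulr0, mul0r, addr0, scaler0).
Qed.

Lemma jet2_ln phi p nu H : 0 < phi p -> jet2 phi p nu H ->
  jet2 (fun x => ln (phi x)) p ((phi p)^-1 *: nu)
    (fun e => H e / phi p - (dot nu e / phi p) ^+ 2).
Proof.
move=> phip jH g g1 g2 cg gp; have [F1 dF [F10 dF1]] := jH _ _ _ cg gp.
have dF0 := nbhs_singleton dF.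
have F00 : phi (g 0) != 0 by rewrite gp gt_eqF.
have Fpos : \forall t \near (0 : R), 0 < (phi \o g) t.
  have /differentiable_continuous cF : differentiable (phi \o g) 0.
    by apply/derivable1_diffP; have [] := dF0.
  apply: (cvgr_gt _ cF); by rewrite /= gp.
exists (fun t => (phi (g t))^-1 * F1 t); last split.
- near=> t; have dFt : is_derive t 1 (phi \o g) (F1 t) by near: t.
  have Ft : 0 < (phi \o g) t by near: t.
  have := is_derive1_comp (is_derive1_ln Ft) dFt.
  by move=> h; apply: (is_derive_eq h).
- by rewrite /= gp dotZl -F10.
- have := is_deriveM (@is_deriveV _ (phi \o g) _ _ _ F00 dF0) dF1.
  move=> h; apply: (is_derive_eq h).
  rewrite /= gp F10 /GRing.scale /= !dot_lin; field.
  by rewrite gt_eqF.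
Unshelve. all: by end_near. Qed.

End SecondOrderCalculus.

(** * Frames adapted to a minimal immersion *)

Section AdaptedFrame.
Context {R : realType}.

(** The directional derivative is written out over the partial derivatives, because
    smoothness is a statement about these and they are the entries of the
    fundamental forms. *)
Definition dirD n (W : normedModType R) (F : 'rV[R]_n -> W) (a x : 'rV[R]_n) : W :=
  \sum_i a 0 i *: partial i F x.

Lemma derive_dirD n (W : normedModType R) (F : 'rV[R]_n -> W) a x :
  differentiable F x -> 'D_a F x = dirD F a x.
Proof.
move=> dF; rewrite deriveE // {1}(row_sum_delta a) linear_sum.
by apply: eq_bigr => i _; rewrite linearZ /= /partial deriveE.
Qed.

Definition secD n (W : normedModType R) (F : 'rV[R]_n -> W) (a x : 'rV[R]_n) : W :=
  \sum_i a 0 i *: dirD (partial i F) a x.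

Lemma near_line n (P : set 'rV[R]_n) (x a : 'rV[R]_n) : (\forall y \near x, P y) ->
  \forall t \near (0 : R), P (x + t *: a).
Proof.
move=> nP; have : {for (0 : R), continuous (fun t : R => x + t *: a)}.
  apply: continuousD; first exact: cst_continuous.
  exact: scalel_continuous.
by apply; rewrite /= scale0r addr0.
Qed.

Lemma C2curve_line n (X : 'rV[R]_n -> 'rV[R]_3) U x a :
  open U -> smooth_on U X -> U x ->
  C2curve (fun t => X (x + t *: a)) (fun t => dirD X a (x + t *: a)) (secD X a x).
Proof.
move=> oU sX Ux; split.
- near=> t; have Ut : U (x + t *: a) by near: t; apply/near_line/open_nbhs_nbhs.
  by rewrite -derive_dirD; [apply: is_derive_line|]; exact: (sX [::]).
- have -> : (fun t => dirD X a (x + t *: a)) =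
      \sum_i (a 0 i *: (fun t : R => partial i X (x + t *: a))).
    by apply/funext => t; rewrite fct_sumE.
  have dp i : is_derive (0 : R) 1 (fun t : R => partial i X (x + t *: a))
      (dirD (partial i X) a x).
    have dx : differentiable (partial i X) x by exact: (sX [:: i]).
    have := @is_derive_line R _ _ (partial i X) x a 0.
    by rewrite scale0r addr0 derive_dirD //; apply.
  exact: is_derive_sum.
Unshelve. all: by end_near. Qed.

Definition row2 (p q : R) : 'rV[R]_2 := \row_i (if i == 0 then p else q).

Lemma dirD_row2 (W : normedModType R) (X : 'rV[R]_2 -> W) p q x :
  dirD X (row2 p q) x = p *: partial 0 X x + q *: partial 1 X x.
Proof.
by rewrite /dirD sum_ord2 !mxE.
Qed.

Lemma dot_dirD2 n (X : 'rV[R]_2 -> 'rV[R]_n) v a x :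
  dot v (dirD X a x) = a 0 0 * dot v (partial 0 X x) + a 0 1 * dot v (partial 1 X x).
Proof.
rewrite /dirD sum_ord2; move: (partial 0 X x) (partial 1 X x) => X0 X1.
by rewrite dotDr !dotZr.
Qed.

Lemma dot_dirD (X : 'rV[R]_2 -> 'rV[R]_3) u w x :
  dot (dirD X u x) (dirD X w x) = (u *m first_form X x *m w^T) 0 0.
Proof.
rewrite dotC {1}/dirD dot_suml mxE; apply: eq_bigr => j _.
rewrite dotZl dotC /dirD dot_suml !mxE mulrC; congr (_ * _).
by apply: eq_bigr => i _; rewrite !mxE dotZl.
Qed.

Lemma dot_secD (X : 'rV[R]_2 -> 'rV[R]_3) u x :
  dot (secD X u x) (unit_normal X x) = (u *m second_form X x *m u^T) 0 0.
Proof.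
rewrite /secD mxE dot_suml; apply: eq_bigr => j _.
rewrite dotZl /dirD dot_suml !mxE mulrC; congr (_ * _); apply: eq_bigr => i _.
by rewrite !mxE dotZl.
Qed.

Section Point.
Variables (X : 'rV[R]_2 -> 'rV[R]_3) (x : 'rV[R]_2).
Hypothesis dX : differentiable X x.
Hypothesis injX : injective ('d X x).

Let X0 := partial 0 X x.
Let X1 := partial 1 X x.

Lemma immersion_independent : independent X0 X1.
Proof.
move=> p q; rewrite -dirD_row2 -derive_dirD // deriveE // => E.
have /injX/rowP h : 'd X x (row2 p q) = 'd X x 0 by rewrite E linear0.
by have := h 0; have := h 1; rewrite !mxE.
Qed.

Lemma dot_unit_normal :
  [/\ dot (unit_normal X x) (unit_normal X x) = 1,
      dot X0 (unit_normal X x) = 0 & dot X1 (unit_normal X x) = 0].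
Proof.
rewrite /unit_normal -/X0 -/X1; have := cross_gt0 immersion_independent.
move: X0 X1 => u w; set c := cross u w => c0.
rewrite !dotZl !dotZr dot_crossl dot_crossr !mulr0; split => //.
by rewrite mulrA -invfM -expr2 sqr_sqrtr ?ltW // mulVf // gt_eqF.
Qed.

(** If the images of the parameter directions [a], [b] are orthonormal, the matrix
    [A] with rows [a], [b] satisfies [A g A^T = 1], hence [g^-1 = A^T A], and the
    trace of the shape operator is the sum of the second form on [a] and on [b]. *)
Lemma minimal_adapted_frame : mean_curvature X x = 0 ->
  exists a b n, orthonormal (dirD X a x) (dirD X b x) n /\
    dot (secD X a x + secD X b x) n = 0.
Proof.
move=> /eqP; rewrite /mean_curvature mulf_eq0 invr_eq0 pnatr_eq0 orbF => /eqP tr0.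
have [nn n0 n1] := dot_unit_normal; set n := unit_normal X x in nn n0 n1.
have [p [q [r]]] := gram_schmidt immersion_independent nn n0 n1.
pose a := row2 p 0; pose b := row2 q r.
have -> : p *: X0 = dirD X a x by rewrite dirD_row2 scale0r addr0.
have -> : q *: X0 + r *: X1 = dirD X b x by rewrite dirD_row2.
move=> orth; exists a, b, n; split => //.
pose A : 'M[R]_2 := \matrix_i (if i == 0 then a else b).
have A0 : row 0 A = a by rewrite rowK.
have A1 : row 1 A = b by rewrite rowK.
have AgA : A *m first_form X x *m A^T = 1%:M.
  apply/matrixP => i j.
  have -> : (A *m first_form X x *m A^T) i j = dot (dirD X (row i A) x) (dirD X (row j A) x).
    rewrite dot_dirD tr_row -!row_mul.
    by rewrite !mxE; apply: eq_bigr => k _; rewrite !mxE.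
  have [[d11 d22 _] [d12 _ _]] := orth.
  have ord2 (k : 'I_2) : k = 0 \/ k = 1.
    by case: k => -[|[|//]] hk; [left|right]; apply/val_inj.
  by case: (ord2 i) => ->; case: (ord2 j) => ->; rewrite ?A0 ?A1 ?d11 ?d22 ?d12 ?mxE //= dotC.
have gAA : first_form X x *m (A^T *m A) = 1%:M.
  by rewrite mulmxA; apply: mulmx1C; rewrite mulmxA.
have gu : first_form X x \in unitmx by case/mulmx1_unit: gAA.
have gi : invmx (first_form X x) = A^T *m A.
  by rewrite -[RHS](mulKmx gu) gAA mulmx1.
move: tr0; rewrite /shape_operator gi -mulmxA mxtrace_mulC /mxtrace !big_ord_recl big_ord0 addr0.
have -> : lift ord0 ord0 = 1 :> 'I_2 by apply/val_inj.
have Q i : (A *m second_form X x *m A^T) i i = dot (secD X (row i A) x) n.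
  rewrite dot_secD tr_row -!row_mul.
  by rewrite !mxE; apply: eq_bigr => k _; rewrite !mxE.
by rewrite !Q A0 A1 dotDl.
Qed.

End Point.
End AdaptedFrame.

(** * Interior minima and barriers *)

Section InteriorMinima.
Context {R : realType}.
Variables (X : 'rV[R]_2 -> 'rV[R]_3) (U : set 'rV[R]_2) (x : 'rV[R]_2).
Hypotheses (oU : open U) (sX : smooth_on U X) (Ux : U x).

Lemma local_min_jet2 phi nu H : jet2 phi (X x) nu H ->
  (\forall y \near x, phi (X x) <= phi (X y)) ->
  forall a, dot nu (dirD X a x) = 0 /\
    0 <= H (dirD X a x) + dot nu (secD X a x).
Proof.
move=> j mphi a; have := j _ _ _ (C2curve_line a oU sX Ux).
rewrite scale0r addr0 => /(_ erefl)[G1 dG [<- dG1]].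
apply: (second_derivative_test dG dG1); rewrite /= scale0r addr0.
exact: (near_line a mphi).
Qed.

(** At a critical point the gradient of [phi] is normal, so the second
    derivatives of [X] contribute only a multiple of the mean curvature: what
    remains of the Laplacian of [phi \o X] is the trace of the ambient Hessian on
    the tangent plane. *)
Lemma local_min_minimal phi nu H : injective ('d X x) -> mean_curvature X x = 0 ->
  jet2 phi (X x) nu H -> (\forall y \near x, phi (X x) <= phi (X y)) ->
  exists e1 e2 n, [/\ orthonormal e1 e2 n, dot nu e1 = 0, dot nu e2 = 0 &
    0 <= H e1 + H e2].
Proof.
move=> injX H0 j mphi; have dX : differentiable X x by exact: (sX [::]).
have [a [b [n [ort sn]]]] := minimal_adapted_frame dX injX H0.
have [na Ha] := local_min_jet2 j mphi a; have [nb Hb] := local_min_jet2 j mphi b.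
exists (dirD X a x), (dirD X b x), n; split => //.
suff : dot nu (secD X a x) + dot nu (secD X b x) = 0 by lra.
by rewrite -dotDr (parseval _ _ ort) na nb sn mulr0 !mul0r !addr0.
Qed.

End InteriorMinima.

Section Barriers.
Context {R : realType}.
Variables (v1 v2 v3 : 'rV[R]_3).
Hypothesis vO : orthonormal v1 v2 v3.

(** With [v3] vertical, this is the squared distance to the vertical axis. *)
Definition rad2 (p : 'rV[R]_3) : R := dot v1 p * dot v1 p + dot v2 p * dot v2 p.

Definition log_barrier (eps : R) (p : 'rV[R]_3) : R :=
  dot v3 p + eps * (ln (rad2 p) + (-2) * (dot v3 p * dot v3 p)).

Definition log_grad (eps : R) (p : 'rV[R]_3) : 'rV[R]_3 :=
  v3 + eps *: ((rad2 p)^-1 *: (2 *: (dot v1 p *: v1 + dot v2 p *: v2)) +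
               (-4 * dot v3 p) *: v3).

Definition log_hess (eps : R) (p e : 'rV[R]_3) : R :=
  eps * (2 * (dot v1 e ^+ 2 + dot v2 e ^+ 2) / rad2 p -
    (2 * (dot v1 p * dot v1 e + dot v2 p * dot v2 e) / rad2 p) ^+ 2 -
    4 * dot v3 e ^+ 2).

Lemma jet2_log_barrier eps p : 0 < rad2 p ->
  jet2 (log_barrier eps) p (log_grad eps p) (log_hess eps p).
Proof.
move=> w0; pose d u := @jet2_dot R u p.
have j1 := jet2_ln w0 (jet2D (jet2M (d v1) (d v1)) (jet2M (d v2) (d v2))).
have := jet2D (d v3) (jet2Z eps (jet2D j1 (jet2Z (-2) (jet2M (d v3) (d v3))))).
move=> j; apply: (jet2_eq j) => [|e]; first by apply/rowP => i; rewrite !mxE; ring.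
by rewrite /log_hess !dot_lin; ring.
Qed.

(** Off the cylinder of radius 1 the logarithm of the horizontal distance is
    superharmonic up to the square of the vertical gradient, which the term in
    the height squared absorbs.  At a critical point the surface is not
    horizontal, hence the strict inequality. *)
Lemma log_barrier_trace eps p e1 e2 n : 0 < eps -> 1 <= rad2 p ->
  orthonormal e1 e2 n ->
  dot (log_grad eps p) e1 = 0 -> dot (log_grad eps p) e2 = 0 ->
  log_hess eps p e1 + log_hess eps p e2 < 0.
Proof.
move=> eps0 w1 eO; rewrite /log_grad /log_hess.
have [[v11 v22 v33] [v12 v13 v23]] := vO; have [[e11 e22 _] _] := eO.
move: (parseval e1 e1 vO) (parseval e2 e2 vO); rewrite e11 e22.
move: (parseval v1 v1 eO) (parseval v2 v2 eO) (parseval v3 v3 eO).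
move: (parseval v1 v2 eO) (parseval v1 v3 eO) (parseval v2 v3 eO).
rewrite v11 v22 v33 v12 v13 v23 !dot_lin !(dotC e1) !(dotC e2).
move: w1; rewrite /rad2; set x1 := dot v1 p; set x2 := dot v2 p; set h := dot v3 p.
set a1 := dot v1 e1; set a2 := dot v2 e1; set a3 := dot v3 e1.
set b1 := dot v1 e2; set b2 := dot v2 e2; set b3 := dot v3 e2.
set n1 := dot v1 n; set n2 := dot v2 n; set n3 := dot v3 n.
move=> w1 o12 o13 o23 q11 q22 q33 r1 r2.
set P := x1 * a1 + x2 * a2; set Q := x1 * b1 + x2 * b2.
pose N := x1 * n1 + x2 * n2; set w := x1 * x1 + x2 * x2 in w1 *.
have w0 : 0 < w by lra.
have Ew : w = P ^+ 2 + Q ^+ 2 + N ^+ 2.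
  transitivity (x1 * x1 * (a1 * a1 + b1 * b1 + n1 * n1) +
    x2 * x2 * (a2 * a2 + b2 * b2 + n2 * n2) +
    2 * x1 * x2 * (a1 * a2 + b1 * b2 + n1 * n2)); last by rewrite /P /Q /N; ring.
  by rewrite -q11 -q22 -o12 !mulr1 mulr0 addr0.
have EN : P * a3 + Q * b3 + N * n3 = 0.
  transitivity (x1 * (a1 * a3 + b1 * b3 + n1 * n3) + x2 * (a2 * a3 + b2 * b3 + n2 * n3)).
    by rewrite /P /Q /N; ring.
  by rewrite -o13 -o23 !mulr0 addr0.
have -> : a1 ^+ 2 + a2 ^+ 2 = 1 - a3 ^+ 2 by rewrite [X in X - _]r1; ring.
have -> : b1 ^+ 2 + b2 ^+ 2 = 1 - b3 ^+ 2 by rewrite [X in X - _]r2; ring.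
clearbody P Q N w a3 b3 n3; move=> crit1 crit2.
(* The squared length of the tangential part of the vertical direction. *)
pose V := a3 ^+ 2 + b3 ^+ 2.
have V0 : 0 < V.
  rewrite lt_def addr_ge0 ?sqr_ge0 // andbT; apply/eqP => V0.
  move/eqP: V0; rewrite paddr_eq0 ?sqr_ge0 // !sqrf_eq0 => /andP[/eqP a30 /eqP b30].
  have k0 : eps * (w^-1 * 2) != 0 by rewrite mulf_neq0 ?gt_eqF // mulr_gt0 ?invr_gt0.
  have P0 : P = 0.
    apply: (mulfI k0); rewrite mulr0 -[RHS]crit1 a30; ring.
  have Q0 : Q = 0.
    apply: (mulfI k0); rewrite mulr0 -[RHS]crit2 b30; ring.
  have n31 : n3 * n3 = 1 by rewrite q33 a30 b30; ring.
  have N0 : N = 0.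
    have : N * n3 * n3 = 0 by move: EN; rewrite P0 Q0 !mul0r !add0r => ->; rewrite mul0r.
    by rewrite -mulrA n31 mulr1.
  by move: w0; rewrite Ew P0 Q0 N0 expr0n /= !addr0 ltxx.
(* Cauchy-Schwarz for (P, Q) and (a3, b3). *)
have NV : N ^+ 2 <= w * V.
  have CS : (N * n3) ^+ 2 <= (P ^+ 2 + Q ^+ 2) * V.
    have -> : N * n3 = - (P * a3 + Q * b3) by lra.
    rewrite -subr_ge0 /V; have -> : (P ^+ 2 + Q ^+ 2) * (a3 ^+ 2 + b3 ^+ 2) -
      (- (P * a3 + Q * b3)) ^+ 2 = (P * b3 - Q * a3) ^+ 2 by ring.
    exact: sqr_ge0.
  have -> : w * V = (P ^+ 2 + Q ^+ 2) * V + N ^+ 2 * V by rewrite Ew; ring.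
  have E2 : N ^+ 2 = (N * n3) ^+ 2 + N ^+ 2 * V.
    by rewrite -{1}(mulr1 (N ^+ 2)) q33 /V; ring.
  by rewrite [leLHS]E2 lerD2r.
rewrite -mulrDr pmulr_rlt0 //.
have -> : 2 * (1 - a3 ^+ 2) / w - (2 * P / w) ^+ 2 - 4 * a3 ^+ 2 +
    (2 * (1 - b3 ^+ 2) / w - (2 * Q / w) ^+ 2 - 4 * b3 ^+ 2) =
    (2 * (2 - V) * w - 4 * (w - N ^+ 2) - 4 * V * w ^+ 2) / w ^+ 2.
  have -> : N ^+ 2 = w - P ^+ 2 - Q ^+ 2 by rewrite [in RHS]Ew; ring.
  by rewrite /V; field; rewrite gt_eqF.
rewrite pmulr_llt0 ?invr_gt0 ?exprn_gt0 //.
have Vw : V * w <= V * w ^+ 2.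
  by rewrite ler_pM2l // expr2 ler_peMl // ltW.
have Vw0 : 0 < V * w by rewrite mulr_gt0.
rewrite -mulrA in NV *; lra.
Qed.

(** Horizontally and near [z], the region where the factor of [eps] is nonpositive
    meets the complement of the open disc with centre [z + rho v1] and radius
    [rho] only at [z]: this factor plays the role of Hopf's exponential barrier. *)
Definition disc_barrier (rho eps : R) (z p : 'rV[R]_3) : R :=
  let xi := dot v1 p + - dot v1 z in let eta := dot v2 p + - dot v2 z in
  dot v3 p + eps * (eta * eta + (-2) * (xi * xi) + (- rho) * xi).

Definition disc_grad (rho eps : R) (z p : 'rV[R]_3) : 'rV[R]_3 :=
  v3 + eps *: ((2 * (dot v2 p + - dot v2 z)) *: v2 +
               (- 4 * (dot v1 p + - dot v1 z) - rho) *: v1).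

Definition disc_hess (eps : R) (e : 'rV[R]_3) : R :=
  eps * (2 * dot v2 e ^+ 2 - 4 * dot v1 e ^+ 2).

Lemma jet2_disc_barrier rho eps z p :
  jet2 (disc_barrier rho eps z) p (disc_grad rho eps z p) (disc_hess eps).
Proof.
pose d u := @jet2_dot R u p.
have j1 := jet2D (d v1) (@jet2_cst R (- dot v1 z) p).
have j2 := jet2D (d v2) (@jet2_cst R (- dot v2 z) p).
have := jet2D (d v3) (jet2Z eps (jet2D (jet2D (jet2M j2 j2) (jet2Z (-2) (jet2M j1 j1)))
  (jet2Z (- rho) j1))).
rewrite !addr0 => j; apply: (jet2_eq j) => [|e].
  by apply/rowP => i; rewrite !mxE; ring.
by rewrite /disc_hess; ring.
Qed.

(** The gradient is normal to the surface, has length at least 1 and a small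
    component along [v1]. So the unit normal [n] has [(n . v1)^2 <= 1/4], and the
    Hessian has trace [eps (2 (1 - (n . v2)^2) - 4 (1 - (n . v1)^2)) < 0]. *)
Lemma disc_barrier_trace rho eps z p e1 e2 n : 0 < eps ->
  `|eps * (- 4 * (dot v1 p + - dot v1 z) - rho)| <= 2^-1 -> orthonormal e1 e2 n ->
  dot (disc_grad rho eps z p) e1 = 0 -> dot (disc_grad rho eps z p) e2 = 0 ->
  disc_hess eps e1 + disc_hess eps e2 < 0.
Proof.
rewrite /disc_grad /disc_hess.
set xi := dot v1 p + _; set eta := dot v2 p + _; set nu := v3 + _.
move=> eps0 small eO nu1 nu2.
have [[v11 v22 v33] [v12 v13 v23]] := vO.
have nuv1 : dot nu v1 = dot nu n * dot v1 n.
  by rewrite (parseval _ _ eO) nu1 nu2 !mul0r !add0r.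
have nunu : dot nu nu = dot nu n ^+ 2.
  by rewrite (parseval _ _ eO) nu1 nu2 !mul0r !add0r.
have nu_ge1 : 1 <= dot nu nu.
  rewrite (parseval nu nu vO) !dot_lin v33 (dotC v3 v1) (dotC v3 v2) v13 v23.
  have -> : forall s t, 1 <= s * s + t * t + (1 + eps * (2 * eta * 0 + (- 4 * xi - rho) * 0)) *
    (1 + eps * (2 * eta * 0 + (- 4 * xi - rho) * 0)) = (0 <= s * s + t * t).
    by move=> s t; rewrite !mulr0 addr0 mulr0 addr0 mulr1 lerDr.
  by rewrite addr_ge0 // -expr2 sqr_ge0.
have E : dot nu v1 = eps * (- 4 * xi - rho).
  by rewrite !dot_lin v11 (dotC v3) (dotC v2) v13 v12; ring.
have n1small : dot v1 n ^+ 2 <= 4^-1.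
  have : dot nu n ^+ 2 * dot v1 n ^+ 2 <= 4^-1.
    rewrite -exprMn -nuv1 E -real_normK ?num_real //.
    have -> : 4^-1 = (2^-1 : R) ^+ 2 by field.
    by rewrite lerXn2r // ?nnegrE ?invr_ge0.
  by apply: le_trans; rewrite ler_peMl ?sqr_ge0 // -nunu.
have := parseval v1 v1 eO; have := parseval v2 v2 eO; rewrite v11 v22 -!expr2 => q2 q1.
have n2 := sqr_ge0 (dot v2 n).
by rewrite -mulrDr pmulr_rlt0 //; lra.
Qed.

End Barriers.

(** * Minimum of the height on a proper minimal surface *)

Section AmbientTopology.
Context {R : realType}.

Lemma dot_continuous (v : 'rV[R]_3) : continuous (dot v).
Proof.
have -> : dot v = fun y => v 0 0 * y 0 0 + v 0 1 * y 0 1 + v 0 2%:R * y 0 2%:R.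
  by apply/funext => y; rewrite dot3E.
move=> y; have cy i : {for y, continuous (fun z : 'rV[R]_3 => v 0 i * z 0 i)}.
  by apply: continuousM; [exact: cst_continuous|exact: coord_continuous].
exact: (continuousD (continuousD (cy 0) (cy 1)) (cy 2%:R)).
Qed.

Lemma sqr_coord_le n (y : 'rV[R]_n) i : y 0 i ^+ 2 <= dot y y.
Proof.
rewrite dotE (bigD1 i) //= expr2 lerDl; apply: sumr_ge0 => j _.
by rewrite -expr2 sqr_ge0.
Qed.

Lemma bounded_dot n (A : set 'rV[R]_n) (C : R) :
  (forall y, A y -> dot y y <= C) -> bounded_set A.
Proof.
move=> AC; exists (Num.sqrt C); split; first exact: num_real.
move=> r Cr y Ay; have r0 : 0 <= r by rewrite ltW // (le_lt_trans _ Cr) ?sqrtr_ge0.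
rewrite /= [leLHS]/Num.Def.normr/= mx_normrE; apply: bigmax_le => // -[i j] _ /=.
rewrite (ord1 i) (le_trans _ (ltW Cr)) // -sqrtr_sqr ler_wsqrtr //.
exact: le_trans (sqr_coord_le _ _) (AC _ Ay).
Qed.

Variables v1 v2 v3 : 'rV[R]_3.

Lemma rad2_continuous : continuous (rad2 v1 v2).
Proof.
move=> y; have cM v := continuousM (@dot_continuous v y) (@dot_continuous v y).
exact: (continuousD (cM v1) (cM v2)).
Qed.

Lemma log_barrier_continuous eps y : 0 < rad2 v1 v2 y ->
  {for y, continuous (log_barrier v1 v2 v3 eps)}.
Proof.
move=> w0; apply: continuousD; first exact: dot_continuous.
apply: continuousM; first exact: cst_continuous.
apply: continuousD.
  by apply: continuous_comp; [exact: rad2_continuous|exact: continuous_ln].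
apply: continuousM; first exact: cst_continuous.
by apply: continuousM; exact: dot_continuous.
Qed.

Hypothesis vO : orthonormal v1 v2 v3.

Lemma compact_shell (m h a w : R) : compact
  [set y | m <= dot v3 y <= h /\ a <= rad2 v1 v2 y <= w].
Proof.
apply: bounded_closed_compact.
  apply: (@bounded_dot _ _ (w + (`|m| + `|h|) ^+ 2)) => y [/andP[my yh] /andP[_ yw]].
  rewrite (parseval _ _ vO) !(dotC y) lerD // -expr2 -real_normK ?num_real //.
  rewrite lerXn2r ?nnegrE ?addr_ge0 // ler_norml; apply/andP; split.
    by have := ler_norm (- m); have := normr_ge0 h; rewrite normrN; lra.
  by have := ler_norm h; have := normr_ge0 m; lra.
have cl (F : 'rV[R]_3 -> R) lo hi : continuous F -> closed [set y | lo <= F y <= hi].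
  move=> cF; have -> : [set y | lo <= F y <= hi] = F @^-1` `[lo, hi].
    by apply/funext => y /=; rewrite in_itv.
  by apply: closed_comp; [move=> *; exact: cF|exact: interval_closed].
by apply: closedI; apply: cl; [exact: dot_continuous|exact: rad2_continuous].
Qed.

End AmbientTopology.

Lemma complete_frame (R : realType) (v : 'rV[R]_3) : dot v v = 1 ->
  exists v1 v2, orthonormal v1 v2 v.
Proof.
move=> vv; have [e e0 ev] : exists2 e : 'rV[R]_3, e != 0 & dot e v = 0.
  have [v00|v00] := eqVneq (v 0 0) 0.
    exists (delta_mx 0 0).
      by apply/eqP => /rowP /(_ 0) /eqP; rewrite !mxE oner_eq0.
    by rewrite dot3E v00 !mxE /= !mul0r mulr0 !addr0.
  exists (\row_i (if i == 0 then - v 0 1 else if i == 1 then v 0 0 else 0)).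
    by apply/eqP => /rowP /(_ 1) /eqP; rewrite !mxE /=; apply/negP.
  by rewrite dot3E !mxE /=; ring.
have n0 := dot_gt0 e0.
exists ((Num.sqrt (dot e e))^-1 *: e); eexists; apply: orthonormal_cross => //.
  by rewrite dotZl dotZr mulrA -invfM -expr2 sqr_sqrtr ?ltW // mulVf // gt_eqF.
by rewrite dotZl ev mulr0.
Qed.

Section Surfaces.
Context {R : realType}.
Variables (M : smooth_surface R) (f : M -> 'rV[R]_3).

Lemma local_paramK (c : chart R M) p : chart_dom c p ->
  local_param f c (chart_map c p) = f p.
Proof. by move=> cp; rewrite /local_param /= chart_mapK. Qed.

Lemma near_chart_inv (c : chart R M) p (P : set M) : chart_dom c p ->
  (\forall q \near p, P q) -> \forall y \near chart_map c p, P (chart_inv c y).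
Proof.
move=> cp nP; have cx : (chart_map c @` chart_dom c) (chart_map c p) by exists p.
have ci : chart_inv c @ chart_map c p --> p.
  by rewrite -{2}(chart_mapK cp); exact: (chart_inv_continuous cx).
exact: ci.
Qed.

Lemma smooth_immersion_continuous : smooth_immersion f -> continuous f.
Proof.
move=> sf p; have [c ac cp] := atlas_cover p.
have cx : chart_codom c (chart_map c p) by exists p.
have dX : differentiable (local_param f c) (chart_map c p) := (sf c ac).1 [::] _ cx.
have h : (local_param f c \o chart_map c) @ p --> f p.
  rewrite -(local_paramK cp); apply: continuous_comp.
    exact: chart_map_continuous.
  exact: differentiable_continuous.
apply: cvg_trans h; apply: near_eq_cvg.
have := open_nbhs_nbhs (conj (@chart_dom_open _ _ c) cp).
by apply: filterS => q cq; rewrite /= local_paramK.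
Qed.

(** The hypothesis on [H] says that [phi] is strictly superharmonic on every
    surface that has a critical point of [phi] at [f p]. *)
Lemma no_strict_superharmonic_min phi p nu H : minimal_immersion f ->
  jet2 phi (f p) nu H ->
  (forall e1 e2 n, orthonormal e1 e2 n -> dot nu e1 = 0 -> dot nu e2 = 0 ->
     H e1 + H e2 < 0) ->
  ~ \forall q \near p, phi (f p) <= phi (f q).
Proof.
move=> [sf H0] j trH mphi; have [c ac cp] := atlas_cover p.
have cx : chart_codom c (chart_map c p) by exists p.
have [sX inj] := sf c ac; rewrite -(local_paramK cp) in j mphi.
have := local_min_minimal (@chart_codom_open _ _ c) sX cx (inj _ cx) (H0 _ ac _ cx) j.
case; first exact: (near_chart_inv cp mphi).
move=> e1 [e2 [n [eO n1 n2]]]; rewrite leNgt => /negP; apply.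
exact: trH eO n1 n2.
Qed.

Variables v1 v2 v3 : 'rV[R]_3.
Hypothesis vO : orthonormal v1 v2 v3.

(** Inside the cylinder of radius 1 the height attains its minimum by compactness.
    Outside, on the part of height at most [m + 1], the height plus a small
    multiple of the superharmonic barrier has no interior minimum. This barrier
    tends to infinity at infinity in the slab and its weight may be taken arbitrarily
    small, so the height is at least its minimum over the boundary. *)
Lemma height_min_attained (b : R) (p : M) : minimal_immersion f -> proper_immersion f ->
  (forall q, b <= dot v3 (f q)) ->
  exists p0, forall q, dot v3 (f p0) <= dot v3 (f q).
Proof.
move=> mf [sf pf] bf; have cf := smooth_immersion_continuous sf.
pose h q := dot v3 (f q); pose w q := rad2 v1 v2 (f q).
have ch : continuous h.
  by move=> q; apply: (@continuous_comp _ _ _ f (dot v3)); [exact: cf|exact: dot_continuous].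
have cw : continuous w.
  by move=> q; apply: (@continuous_comp _ _ _ f (rad2 v1 v2)); [exact: cf|exact: rad2_continuous].
have w_ge0 q : 0 <= w q by rewrite addr_ge0 // -expr2 sqr_ge0.
pose m := inf (range h).
have hi : has_inf (range h) by split; [exists (h p), p|exists b => _ [q _ <-]; exact: bf].
have mh q : m <= h q by apply: inf_lbound; [case: hi|exists q].
pose K := [set q | m <= h q <= m + 1 /\ 0 <= w q <= 1].
have cK : compact K := pf _ (@compact_shell _ _ _ _ vO m (m + 1) 0 1).
(* [outside] carries a bound from the cylinder over to the whole surface. *)
suff outside c0 : c0 <= m + 1 -> (forall q, K q -> c0 <= h q) -> forall q, c0 <= h q.
  have [K0|/set0P/negP/negPn/eqP K0] := pselect (K !=set0); last first.
    have : m + 1 <= m.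
      apply: lb_le_inf; first by exists (h p), p.
      by move=> _ [q _ <-]; apply: outside => // q' ; rewrite K0.
    by rewrite gerDl ler10.
  have [|p0 p0K minK] := compact_EVT_min K0 cK (f := h).
    exact: continuous_subspaceT.
  exists p0; apply: outside; first by move: p0K; rewrite inE => -[/andP[]].
  by move=> q Kq; apply: minK; rewrite inE.
move=> c0m c0K q; rewrite leNgt; apply/negP => hq.
have wq : 1 < w q.
  rewrite ltNge; apply/negP => wq; have := c0K q; rewrite leNgt hq => /(_ _)/negP; case=> //.
  by rewrite /K /= mh (le_trans (ltW hq) c0m) w_ge0 wq.
pose C := 2 * (`|m| + 1) ^+ 2.
have C0 : 0 < C by rewrite mulr_gt0 // exprn_gt0 // ltr_pwDr.
have hC r : m <= h r <= m + 1 -> 2 * (h r * h r) <= C.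
  move=> /andP[h1 h2]; rewrite ler_pM2l // -expr2 -real_normK ?num_real //.
  rewrite lerXn2r ?nnegrE ?addr_ge0 // ler_norml.
  by have := ler_norm m; have := ler_norm (- m); rewrite normrN => *; apply/andP; split; lra.
have lnq : 0 < ln (w q) by rewrite ln_gt0.
(* Small enough for [q] to contradict the bound even after the loss [eps * C]
   due to the squared height. *)
pose eps := (c0 - h q) / (2 * (ln (w q) + C)).
have d0 : 0 < ln (w q) + C by rewrite addr_gt0.
have eps0 : 0 < eps by rewrite divr_gt0 ?subr_gt0 ?mulr_gt0.
have epsE : eps * (ln (w q) + C) = (c0 - h q) / 2.
  by rewrite /eps; field; rewrite gt_eqF.
(* At this squared radius the logarithm alone outweighs the gap [c0 - m]. *)
pose W := expR ((c0 - m) / eps).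
have lnW : eps * ln W = c0 - m by rewrite expRK; field; rewrite gt_eqF.
have qW : w q < W.
  rewrite -ltr_ln ?posrE ?expR_gt0 ?(lt_trans _ wq) // -(ltr_pM2l eps0) lnW.
  have := mh q; have : 0 < eps * C by rewrite mulr_gt0.
  by move: epsE; rewrite mulrDr; lra.
pose N := [set r | m <= h r <= m + 1 /\ 1 <= w r <= W].
have cN : compact N := pf _ (@compact_shell _ _ _ _ vO m (m + 1) 1 W).
have Nq : N q by rewrite /N /= mh (le_trans (ltW hq) c0m) !ltW.
pose u r := log_barrier v1 v2 v3 eps (f r).
have [||r Nr minN] := @compact_EVT_min _ _ u N _ cN.
- by exists q.
- apply: continuous_in_subspaceT => r; rewrite inE => -[_ /andP[w1 _]].
  apply: (@continuous_comp _ _ _ f (log_barrier v1 v2 v3 eps)); first exact: cf.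
  by apply: log_barrier_continuous => //; exact: lt_le_trans ltr01 w1.
move: Nr; rewrite inE => -[/andP[mr rm] /andP[w1 wW]].
have hCr : 2 * (h r * h r) <= C by apply: hC; rewrite mr rm.
have ur : u r < c0 - eps * C.
  apply: (le_lt_trans (minN q _)); first by rewrite inE.
  rewrite /u /log_barrier -/(h q) -/(w q).
  have : 0 <= eps * (h q * h q) by rewrite mulr_ge0 ?(ltW eps0) // -expr2 sqr_ge0.
  move: epsE; rewrite mulrDr; lra.
have {}ur : h r + eps * ln (w r) < c0.
  have : eps * (2 * (h r * h r)) <= eps * C by rewrite ler_pM2l.
  by move: ur; rewrite /u /log_barrier -/(h r) -/(w r); lra.
have lnr : 0 <= eps * ln (w r) by rewrite mulr_ge0 ?(ltW eps0) // ln_ge0.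
have {}w1 : 1 < w r.
  rewrite lt_def w1 andbT; apply/eqP => wr1; have := c0K r; rewrite leNgt.
  have -> : h r < c0 by lra.
  by move=> /(_ _)/negP; case=> //; rewrite /K /= mr rm w_ge0 wr1 lexx.
have {}rm : h r < m + 1 by lra.
have {}wW : w r < W.
  rewrite -ltr_ln ?posrE ?expR_gt0 ?(lt_trans _ w1) // -(ltr_pM2l eps0) lnW; lra.
have w0 : 0 < rad2 v1 v2 (f r) by exact: lt_trans ltr01 w1.
apply: (no_strict_superharmonic_min mf (@jet2_log_barrier _ v1 v2 v3 eps _ w0) _ (p := r)).
  by move=> e1 e2 n eO; exact: (log_barrier_trace vO eps0 (ltW w1) eO).
near=> r'; apply: minN; rewrite inE; split; apply/andP; split => //.
- by apply: ltW; near: r'; exact: (cvgr_lt _ (ch r)).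
- by apply: ltW; near: r'; exact: (cvgr_gt _ (cw r)).
- by apply: ltW; near: r'; exact: (cvgr_lt _ (cw r)).
Unshelve. all: by end_near. Qed.

End Surfaces.

(** * Local injectivity of the horizontal projection *)

Section LocalInjectivity.
Context {R : realType}.

Lemma segment_ball n (x y y' : 'rV[R]_n) r t :
  `|x - y| < r -> `|x - y'| < r -> 0 <= t -> t <= 1 ->
  `|x - (y + t *: (y' - y))| < r.
Proof.
move=> yr y'r t0 t1.
have -> : x - (y + t *: (y' - y)) = (1 - t) *: (x - y) + t *: (x - y').
  by apply/rowP => i; rewrite !mxE; ring.
apply: (le_lt_trans (ler_normD _ _)).
rewrite !normrZ (ger0_norm t0) ger0_norm ?subr_ge0 //.
have [->|t1'] := eqVneq t 1; first by rewrite subrr mul0r add0r mul1r.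
have h1 : (1 - t) * `|x - y| < (1 - t) * r.
  by rewrite ltr_pM2l // subr_gt0 lt_neqAle t1' t1.
have h2 : t * `|x - y'| <= t * r by rewrite ler_wpM2l // ltW.
by lra.
Qed.

Variables v1 v2 v3 : 'rV[R]_3.
Hypothesis vO : orthonormal v1 v2 v3.

Definition jac_coef (X : 'rV[R]_2 -> 'rV[R]_3) (k i : 'I_2) (y : 'rV[R]_2) : R :=
  dot (if k == 0 then v1 else v2) (partial i X y).

(** Rolle's theorem along a segment, applied to each of the two horizontal
    coordinates, yields two different points: the rows of the determinant have
    to be taken at independent points. *)
Definition mixed_jac X (p : 'rV[R]_2 * 'rV[R]_2) : R :=
  jac_coef X 0 0 p.1 * jac_coef X 1 1 p.2 - jac_coef X 0 1 p.1 * jac_coef X 1 0 p.2.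

Lemma mixed_jac_neq0 X x : independent (partial 0 X x) (partial 1 X x) ->
  dot v3 (partial 0 X x) = 0 -> dot v3 (partial 1 X x) = 0 ->
  mixed_jac X (x, x) != 0.
Proof.
move=> ind h0 h1; apply/eqP; rewrite /mixed_jac /jac_coef /=.
move: (partial 0 X x) (partial 1 X x) ind h0 h1 => X0 X1 ind h0 h1 D0.
have z0 p q : dot v1 (p *: X0 + q *: X1) = 0 -> dot v2 (p *: X0 + q *: X1) = 0 ->
    p = 0 /\ q = 0.
  set z := p *: X0 + q *: X1 => k1 k2; apply: ind; rewrite -/z.
  have k3 : dot v3 z = 0 by rewrite /z !dot_lin h0 h1 !mulr0 addr0.
  apply/eqP/negPn/negP => /dot_gt0.
  by rewrite (parseval _ _ vO) !(dotC z) k1 k2 k3 !mulr0 !addr0 ltxx.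
have [||d1 d0] := z0 (dot v1 X1) (- dot v1 X0).
- by rewrite !dot_lin; ring.
- by rewrite !dot_lin -[RHS]oppr0 -D0; ring.
have [||c1 c0] := z0 (dot v2 X1) (- dot v2 X0).
- by rewrite !dot_lin -[RHS]D0; ring.
- by rewrite !dot_lin; ring.
have [] : 1 = 0 :> R /\ 0 = 0 :> R.
  apply: z0; rewrite !dot_lin.
    by move/eqP: d0; rewrite oppr_eq0 => /eqP ->; rewrite !mul0r mulr0 addr0.
  by move/eqP: c0; rewrite oppr_eq0 => /eqP ->; rewrite !mul0r mulr0 addr0.
by move/eqP; rewrite oner_eq0.
Qed.

(** If [y] and [y'] had the same horizontal projection, [y' - y] would be in the
    kernel of a matrix whose determinant is a value of [mixed_jac] near [(x, x)]. *)
Lemma horizontal_locally_injective X (U : set 'rV[R]_2) x :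
  open U -> smooth_on U X -> U x ->
  independent (partial 0 X x) (partial 1 X x) ->
  dot v3 (partial 0 X x) = 0 -> dot v3 (partial 1 X x) = 0 ->
  exists2 r : R, 0 < r & forall y y', `|x - y| < r -> `|x - y'| < r ->
    U y /\ (rad2 v1 v2 (X y - X y') = 0 -> y = y').
Proof.
move=> oU sX Ux ind h0 h1; have D0 := mixed_jac_neq0 ind h0 h1.
have cj k i : {for x, continuous (jac_coef X k i)}.
  apply: (@continuous_comp _ _ _ (partial i X)); last exact: dot_continuous.
  by apply: differentiable_continuous; exact: (sX [:: i]).
have cD : {for (x, x), continuous (mixed_jac X)}.
  have c1 k i : {for (x, x), continuous (fun p => jac_coef X k i p.1)}.
    by apply: (@continuous_comp _ _ _ fst); [exact: cvg_fst|exact: cj].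
  have c2 k i : {for (x, x), continuous (fun p => jac_coef X k i p.2)}.
    by apply: (@continuous_comp _ _ _ snd); [exact: cvg_snd|exact: cj].
  exact: (continuousB (continuousM (c1 0 0) (c2 1 1)) (continuousM (c1 0 1) (c2 1 0))).
have /nbhs_ballP[r1 /= r10 hr1] : nbhs (x, x) [set p | mixed_jac X p != 0].
  exact: (cvgr_neq0 _ cD D0).
have /nbhs_ballP[r2 /= r20 hr2] : nbhs x U by exact: open_nbhs_nbhs.
exists (Num.min r1 r2); first by rewrite lt_min r10 r20.
have toU y : `|x - y| < Num.min r1 r2 -> U y.
  by rewrite lt_min => /andP[_ yr]; apply: hr2; rewrite -ball_normE.
move=> y y' yr y'r; split; first exact: toU.
set d := y' - y.
move=> /eqP; rewrite /rad2 -!expr2 paddr_eq0 ?sqr_ge0 // !sqrf_eq0 !dot_lin !subr_eq0.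
move=> /andP[/eqP e1 /eqP e2].
have roll v : dot v (X y) = dot v (X y') ->
    exists2 p, `|x - p| < Num.min r1 r2 & dot v (dirD X d p) = 0.
  move=> ev; pose g (t : R) := dot v (X (y + t *: d)).
  have dg (t : R) : 0 <= t -> t <= 1 -> is_derive t 1 g (dot v (dirD X d (y + t *: d))).
    move=> t0 t1; have Ut := toU _ (segment_ball yr y'r t0 t1).
    apply: is_derive_dot; rewrite -derive_dirD; last exact: (sX [::]).
    by apply: is_derive_line; exact: (sX [::]).
  have [| | |t] := @Rolle _ g 0 1 ltr01.
  - by move=> t; rewrite in_itv /= => /andP[/ltW t0 /ltW t1]; have [] := dg t t0 t1.
  - apply: derivable_within_continuous => t; rewrite in_itv /= => /andP[t0 t1].
    by have [] := dg t t0 t1.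
  - by rewrite /g scale0r addr0 scale1r /d addrC subrK.
  rewrite in_itv /= => /andP[/ltW t0 /ltW t1] [_ gt].
  exists (y + t *: d); first exact: segment_ball.
  by have [_ <-] := dg t t0 t1.
have [p1 p1r q1] := roll v1 e1; have [p2 p2r q2] := roll v2 e2.
have Dp : mixed_jac X (p1, p2) != 0.
  apply: hr1; split; rewrite -ball_normE /=.
    by move: p1r; rewrite lt_min => /andP[].
  by move: p2r; rewrite lt_min => /andP[].
rewrite !dot_dirD2 in q1 q2; rewrite /mixed_jac /jac_coef /= in Dp.
have [d0 d1] := cramer2 Dp q1 q2.
apply/esym/eqP; rewrite -subr_eq0 -/d; apply/eqP/rowP => i; rewrite [RHS]mxE.
by case: i => -[|[|//]] hi; [rewrite -[RHS]d0|rewrite -[RHS]d1]; congr (d _ _); apply/val_inj.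
Qed.

End LocalInjectivity.

Section CompactBalls.
Context {R : realType}.

Definition cball n (x : 'rV[R]_n) (r : R) : set 'rV[R]_n := [set y | `|x - y| <= r].

Lemma dist_continuous n (x : 'rV[R]_n) : continuous (fun y : 'rV[R]_n => `|x - y|).
Proof.
move=> y; apply: (@continuous_comp _ _ _ (fun y : 'rV[R]_n => x - y) Num.norm); last exact: norm_continuous.
by apply: continuousB; [exact: cst_continuous|].
Qed.

Lemma cball_compact n (x : 'rV[R]_n) r : compact (cball x r).
Proof.
apply: bounded_closed_compact.
  exists (`|x| + r); split; first exact: num_real.
  move=> s rs y /= yr; apply: le_trans (ltW rs).
  by rewrite -[y](subrK x) (le_trans (ler_normD _ _)) // addrC lerD2l distrC.
have -> : cball x r = (fun y : 'rV[R]_n => `|x - y|) @^-1` [set t | t <= r] by [].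
by apply: closed_comp; [move=> *; exact: dist_continuous|exact: closed_le].
Qed.

Lemma sublevel_compact (T : topologicalType) (K : set T) (g : T -> R) t :
  hausdorff_space T -> compact K -> (forall y, K y -> {for y, continuous g}) ->
  compact (K `&` [set y | g y <= t]).
Proof.
move=> hT cK cg; apply: (subclosed_compact _ cK); last by move=> y [].
move=> y cly; have Ky : K y.
  by apply: (compact_closed hT cK) => B /cly[z [[Kz _] Bz]]; exists z.
split=> //=; rewrite leNgt; apply/negP => ty.
have [z [[_ /=]]] := cly _ (cvgr_gt _ (cg y Ky) t ty).
by rewrite leNgt => /negP.
Qed.

Lemma compact_pos_lb (T : topologicalType) (K : set T) (g : T -> R) :
  compact K -> (forall y, K y -> {for y, continuous g}) -> (forall y, K y -> 0 < g y) ->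
  exists2 c, 0 < c & forall y, K y -> c <= g y.
Proof.
move=> cK cg g0; have [K0|/set0P/negP/negPn/eqP K0] := pselect (K !=set0); last first.
  by exists 1 => // y; rewrite K0.
have [|c cK' minc] := compact_EVT_min K0 cK (f := g).
  by apply: continuous_in_subspaceT => y; rewrite inE; exact: cg.
by exists (g c) => [|y Ky]; [apply: g0; rewrite inE in cK'|apply: minc; rewrite inE].
Qed.

Lemma sphere_compact n (x : 'rV[R]_n) r : compact [set y | `|x - y| = r].
Proof.
have -> : [set y | `|x - y| = r] = cball x r `&` [set y | - `|x - y| <= - r].
  apply/seteqP; split=> y /=; first by rewrite /cball /= => ->; rewrite !lexx.
  by rewrite /cball /= lerN2 => -[h1 h2]; apply/eqP; rewrite eq_le h1 h2.
apply: sublevel_compact; [exact: norm_hausdorff|exact: cball_compact|] => y _.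
by apply: continuousN; exact: dist_continuous.
Qed.

End CompactBalls.

(** * The strong maximum principle *)

Section StrongMaximumPrinciple.
Context {R : realType}.
Variables (X : 'rV[R]_2 -> 'rV[R]_3) (U : set 'rV[R]_2).
Hypotheses (oU : open U) (sX : smooth_on U X).
Hypothesis injX : forall y, U y -> injective ('d X y).
Hypothesis minX : forall y, U y -> mean_curvature X y = 0.
Variables (v1 v2 v3 : 'rV[R]_3) (m : R).
Hypothesis vO : orthonormal v1 v2 v3.
Hypothesis mX : forall y, U y -> m <= dot v3 (X y).

Lemma param_continuous y : U y -> {for y, continuous X}.
Proof. by move=> Uy; apply: differentiable_continuous; exact: (sX [::]). Qed.

Lemma param_comp_continuous (F : 'rV[R]_3 -> R) y : continuous F -> U y ->
  {for y, continuous (fun y => F (X y))}.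
Proof.
move=> cF Uy; apply: (@continuous_comp _ _ _ X F); first exact: param_continuous.
exact: cF.
Qed.

Lemma diff_rad2_continuous z y : U y ->
  {for y, continuous (fun y => rad2 v1 v2 (X y - z))}.
Proof.
apply: (param_comp_continuous (F := fun p => rad2 v1 v2 (p - z))) => p.
apply: (@continuous_comp _ _ _ (fun p : 'rV[R]_3 => p - z)); last exact: rad2_continuous.
by apply: continuousB; [|exact: cst_continuous].
Qed.

(** The first vector is the normalized horizontal part of [u]; the horizontal
    distance does not depend on the horizontal frame. *)
Lemma direction_frame (u : 'rV[R]_3) : 0 < rad2 v1 v2 u ->
  exists e1 e2, [/\ orthonormal e1 e2 v3,
    dot e1 u = Num.sqrt (rad2 v1 v2 u), dot e2 u = 0 &
    forall p, rad2 v1 v2 p = dot e1 p ^+ 2 + dot e2 p ^+ 2].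
Proof.
move=> u0; set rho := Num.sqrt _.
have rho2 : rho ^+ 2 = rad2 v1 v2 u by rewrite sqr_sqrtr // ltW.
have rho0 : 0 < rho by rewrite sqrtr_gt0.
have [[v11 v22 v33] [v12 v13 v23]] := vO.
pose e1 := rho^-1 *: (dot v1 u *: v1 + dot v2 u *: v2).
have e1e1 : dot e1 e1 = 1.
  rewrite /e1 !dot_lin v11 v22 (dotC v2 v1) v12.
  transitivity (rho^-1 ^+ 2 * rad2 v1 v2 u); first by rewrite /rad2; ring.
  by rewrite -rho2 -exprMn mulVf ?gt_eqF // expr1n.
have e1v3 : dot e1 v3 = 0 by rewrite /e1 !dot_lin v13 v23 !mulr0 addr0 mulr0.
have eO := orthonormal_cross v33 e1e1 e1v3.
have rE p : rad2 v1 v2 p = dot e1 p ^+ 2 + dot (cross v3 e1) p ^+ 2.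
  have := parseval p p vO; rewrite (parseval p p eO) !(dotC p) /rad2 -!expr2.
  by move=> /addIr ->.
have e1u : dot e1 u = rho.
  rewrite /e1 !dot_lin; transitivity (rho^-1 * rad2 v1 v2 u); first by rewrite /rad2; ring.
  by rewrite -rho2 expr2 mulrA mulVf ?gt_eqF // mul1r.
exists e1, (cross v3 e1); split => //.
have := rE u; rewrite e1u -rho2 -[LHS]addr0 => /addrI /esym /eqP.
by rewrite sqrf_eq0 => /eqP.
Qed.

Lemma rad2D u w : rad2 v1 v2 (u + w) <= 2 * rad2 v1 v2 u + 2 * rad2 v1 v2 w.
Proof.
rewrite /rad2 !dotDr; set a := dot v1 u; set b := dot v2 u.
set c := dot v1 w; set d := dot v2 w.
have := sqr_ge0 (a - c); have := sqr_ge0 (b - d).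
rewrite !expr2; lra.
Qed.

Lemma rad2N u : rad2 v1 v2 (- u) = rad2 v1 v2 u.
Proof. by rewrite /rad2 !dotNr !mulrNN. Qed.

Lemma rad2_ge0 u : 0 <= rad2 v1 v2 u.
Proof. by rewrite addr_ge0 // -expr2 sqr_ge0. Qed.

Lemma lowest_tangent x : U x -> dot v3 (X x) = m -> forall a, dot v3 (dirD X a x) = 0.
Proof.
move=> Ux xm a.
have [] // := local_min_jet2 oU sX Ux (@jet2_dot _ v3 (X x)) _ a.
have nU : \forall y \near x, U y by exact: open_nbhs_nbhs.
by apply: filterS nU => y Uy; rewrite xm mX.
Qed.

(** The contact configuration of Hopf's argument is impossible: the lowest
    points [y] near [y0] stay outside the horizontal disc with centre [X q] that
    passes through [X y0]. The minimum of the height plus a small multiple of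
    the disc barrier over a small ball about [y0] is interior, because on the
    boundary sphere either the barrier is positive or the height is bounded away
    from [m]. *)
Lemma no_interior_contact (q y0 : 'rV[R]_2) (r : R) : 0 < r -> U q ->
  (forall y, `|y0 - y| <= r -> U y) ->
  dot v3 (X y0) = m -> 0 < rad2 v1 v2 (X q - X y0) ->
  (forall y, `|y0 - y| <= r -> rad2 v1 v2 (X y - X y0) = 0 -> y = y0) ->
  (forall y, `|y0 - y| <= r -> dot v3 (X y) = m ->
    rad2 v1 v2 (X q - X y0) <= rad2 v1 v2 (X q - X y)) -> False.
Proof.
move=> r0 Uq rU y0m w0 inj0 disc.
have Uy0 : U y0 by apply: rU; rewrite subrr normr0 ltW.
have [e1 [e2 [eO e1u e2u rE]]] := direction_frame w0.
set rho := Num.sqrt _ in e1u.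
have rho0 : 0 < rho by rewrite sqrtr_gt0.
have rho2 : rho ^+ 2 = rad2 v1 v2 (X q - X y0) by rewrite sqr_sqrtr // ltW.
pose xi y := dot e1 (X y) + - dot e1 (X y0).
pose eta y := dot e2 (X y) + - dot e2 (X y0).
have xiE y : xi y = dot e1 (X y - X y0) by rewrite dotDr dotNr.
have etaE y : eta y = dot e2 (X y - X y0) by rewrite dotDr dotNr.
pose b y := eta y * eta y + (-2) * (xi y * xi y) + (- rho) * xi y.
have cxi y : U y -> {for y, continuous xi}.
  apply: (param_comp_continuous (F := fun p => dot e1 p + - dot e1 (X y0))) => p.
  by apply: continuousD; [exact: dot_continuous|exact: cst_continuous].
have ceta y : U y -> {for y, continuous eta}.
  apply: (param_comp_continuous (F := fun p => dot e2 p + - dot e2 (X y0))) => p.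
  by apply: continuousD; [exact: dot_continuous|exact: cst_continuous].
have cb y : U y -> {for y, continuous b}.
  move=> Uy; apply: continuousD; last first.
    by apply: continuousM; [exact: cst_continuous|exact: cxi].
  apply: continuousD; first by apply: continuousM; exact: ceta.
  by apply: continuousM; [exact: cst_continuous|apply: continuousM; exact: cxi].
have ch y : U y -> {for y, continuous (fun y => dot v3 (X y))}.
  by apply: param_comp_continuous; exact: dot_continuous.
have [s [s0 sr sxi]] : exists s, [/\ 0 < s, s <= r & forall y, `|y0 - y| <= s -> `|xi y| < rho / 4].
  have xi0 : xi y0 = 0 by rewrite /xi subrr.
  have nxi : \forall y \near y0, `|xi y| < rho / 4.
    have c0 : xi @ y0 --> 0 by rewrite -xi0; exact: cxi.
    by apply: (cvgr0_norm_lt _ c0); rewrite divr_gt0.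
  have /nbhs_ballP[d /= d0 hd] := nxi.
  exists (Num.min r (d / 2)); split.
  - by rewrite lt_min r0 divr_gt0.
  - by rewrite ge_min lexx.
  - move=> y; rewrite le_min => /andP[_ yd]; apply: hd; rewrite -ball_normE /=.
    by apply: le_lt_trans yd _; rewrite ltr_pdivrMr // ltr_pMr // ltr1n.
have sU y : `|y0 - y| <= s -> U y by move=> ys; apply: rU; exact: le_trans sr.
(* A lowest point outside the disc satisfies [xi ^ 2 + eta ^ 2 >= 2 rho xi], which
   with [b <= 0] forces [xi = eta = 0]. *)
have contact y : `|y0 - y| = s -> b y <= 0 -> m < dot v3 (X y).
  move=> ys by0; have ysl : `|y0 - y| <= s by rewrite ys.
  rewrite lt_neqAle mX ?andbT; last exact: sU.
  apply/eqP => ym; have yr : `|y0 - y| <= r by exact: le_trans sr.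
  have qE : X q - X y = (X q - X y0) - (X y - X y0) by rewrite opprB addrA subrK.
  have q1 : dot e1 (X q - X y) = rho - xi y by rewrite qE dotDr dotNr e1u xiE.
  have q2 : dot e2 (X q - X y) = - eta y by rewrite qE dotDr dotNr e2u sub0r etaE.
  have := disc y yr (esym ym); rewrite -rho2 rE q1 q2 sqrrN => dsc.
  have /ltr_normlP[x1 x2] := sxi y ysl.
  have et0 : 0 <= eta y * eta y by rewrite -expr2 sqr_ge0.
  rewrite !expr2 in dsc; rewrite /b in by0.
  have x0 : xi y = 0.
    apply/eqP; rewrite eq_le; apply/andP; split; rewrite leNgt; apply/negP => xp.
      have k2 : 0 < rho - 3 * xi y by lra.
      by have := mulr_gt0 xp k2; lra.
    have k1 : 0 < - xi y by lra.
    have k2 : 0 < rho + 2 * xi y by lra.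
    by have := mulr_gt0 k1 k2; lra.
  have e0 : eta y * eta y = 0 by apply/eqP; rewrite eq_le et0 andbT; move: by0; rewrite x0; lra.
  have : y = y0.
    by apply: inj0 => //; rewrite rE -xiE -etaE x0 expr2 mul0r add0r expr2.
  by move=> yy; move: s0; rewrite -ys yy subrr normr0 ltxx.
have [c c0 hc] : exists2 c, 0 < c & forall y, `|y0 - y| = s -> b y <= 0 -> c <= dot v3 (X y) - m.
  have [|y [ys _]|y [ys yb]|c c0 hc] := @compact_pos_lb R _
    ([set y | `|y0 - y| = s] `&` [set y | b y <= 0]) (fun y => dot v3 (X y) - m).
  - apply: sublevel_compact; [exact: norm_hausdorff|exact: sphere_compact|] => y ys.
    by apply/cb/sU; rewrite ys.
  - apply: continuousB; last exact: cst_continuous.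
    by apply/ch/sU; rewrite ys.
  - by rewrite subr_gt0; exact: contact.
  - by exists c => // y ys yb; apply: hc.
(* The first bound serves the boundary sphere, the second the trace condition. *)
pose eps := Num.min (c / (2 * rho ^+ 2)) (4 * rho)^-1.
have rr0 : 0 < rho ^+ 2 by rewrite exprn_gt0.
have eps0 : 0 < eps by rewrite lt_min divr_gt0 ?mulr_gt0 // invr_gt0 mulr_gt0.
have epsc : eps * rho ^+ 2 < c.
  apply: (@le_lt_trans _ _ (c / 2)); last by rewrite ltr_pdivrMr // ltr_pMr // ltr1n.
  have -> : c / 2 = c / (2 * rho ^+ 2) * rho ^+ 2 by field; rewrite gt_eqF.
  by rewrite ler_pM2r // ge_min lexx.
have epsr : eps * (2 * rho) <= 2^-1.
  have -> : 2^-1 = (4 * rho)^-1 * (2 * rho) by field; rewrite gt_eqF.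
  by rewrite ler_pM2r ?mulr_gt0 // ge_min lexx orbT.
(* Only [2 xi ^ 2 + rho xi] counts against [b], and [|xi| <= rho / 4] on this ball. *)
have b_lb y : `|y0 - y| <= s -> - rho ^+ 2 <= b y.
  move=> ys; have /ltr_normlP[x1 x2] := sxi y ys.
  have et0 : 0 <= eta y * eta y by rewrite -expr2 sqr_ge0.
  have k1 : 0 <= rho / 4 - xi y by lra.
  have k2 : 0 <= rho / 4 + xi y by lra.
  have := mulr_ge0 k1 k2; have := mulr_ge0 (ltW rho0) k1.
  by move: rr0; rewrite /b expr2; lra.
pose u y := dot v3 (X y) + eps * b y.
have cu y : U y -> {for y, continuous u}.
  move=> Uy; apply: continuousD; first exact: ch.
  by apply: continuousM; [exact: cst_continuous|exact: cb].
have [||y1 y1B miny1] := @compact_EVT_min _ _ u (cball y0 s) _ (@cball_compact _ _ y0 s).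
- by exists y0; rewrite /cball /= subrr normr0 ltW.
- apply: continuous_in_subspaceT => y; rewrite inE => yB.
  exact/cu/sU.
rewrite inE /cball /= in y1B.
have u0 : u y0 = m by rewrite /u /b /xi /eta !subrr y0m; ring.
have u1 : u y1 <= m.
  by rewrite -u0; apply: miny1; rewrite inE /cball /= subrr normr0 ltW.
have y1s : `|y0 - y1| < s.
  rewrite lt_neqAle y1B andbT; apply/eqP => ys.
  have my1 : m <= dot v3 (X y1) by apply/mX/sU.
  have [b0|b0] := lerP (b y1) 0.
    have := hc y1 ys b0; have : - (eps * rho ^+ 2) <= eps * b y1.
      by rewrite -mulrN ler_pM2l // b_lb.
    by move: u1; rewrite /u; lra.
  by have := mulr_gt0 eps0 b0; move: u1; rewrite /u; lra.
have Uy1 := sU _ y1B.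
have /ltr_normlP[x1 x2] := sxi y1 y1B.
have [|f1 [f2 [n [fO n1 n2]]]] := local_min_minimal oU sX Uy1 (injX Uy1) (minX Uy1)
  (@jet2_disc_barrier _ e1 e2 v3 rho eps (X y0) (X y1)).
  have : \forall y \near y1, `|y0 - y| < s by apply: (cvgr_lt _ (@dist_continuous _ _ y0 y1)).
  by apply: filterS => y ys; apply: miny1; rewrite inE; exact: ltW.
rewrite leNgt => /negP; apply.
apply: (disc_barrier_trace eO eps0 _ fO n1 n2 (z := X y0) (p := X y1) (rho := rho)).
rewrite normrM (gtr0_norm eps0); apply: le_trans epsr.
rewrite ler_pM2l // ler_norml -/(xi y1); apply/andP; split; lra.
Qed.

(** Hopf's strong maximum principle for the height: if [x] were a limit of
    points that are not lowest, take such a point [q] close to [x] and its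
    horizontally nearest lowest point. *)
Lemma lowest_points_open x : U x -> dot v3 (X x) = m ->
  \forall y \near x, dot v3 (X y) = m.
Proof.
move=> Ux xm; have tg := lowest_tangent Ux xm.
have dX : differentiable X x by exact: (sX [::]).
have pE i : partial i X x = dirD X (delta_mx 0 i) x by rewrite -derive_dirD.
have [r r0 hr] := horizontal_locally_injective vO oU sX Ux
  (immersion_independent dX (injX Ux)) (etrans (congr1 _ (pE 0)) (tg _))
  (etrans (congr1 _ (pE 1)) (tg _)).
pose r' := r / 2.
have r'0 : 0 < r' by rewrite divr_gt0.
have r'r : r' < r by rewrite ltr_pdivrMr // ltr_pMr // ltr1n.
have inB y : `|x - y| <= r' -> `|x - y| < r by move=> ?; exact: le_lt_trans r'r.
have BU y : `|x - y| < r -> U y by move=> yr; have [] := hr y y yr yr.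
have xx : `|x - x| < r by rewrite subrr normr0.
pose w y y' := rad2 v1 v2 (X y - X y').
have wC y y' : w y y' = w y' y by rewrite /w -rad2N opprB.
have winj y y' : `|x - y| < r -> `|x - y'| < r -> w y y' = 0 -> y = y'.
  by move=> yr y'r; have [] := hr y y' yr y'r.
have wD y y' y'' : w y y'' <= 2 * w y y' + 2 * w y' y''.
  by rewrite /w -(subrKA (X y')); exact: rad2D.
have cw z y : `|x - y| < r -> {for y, continuous (fun y => w y z)}.
  by move=> yr; apply: diff_rad2_continuous; exact: BU.
have [y /= ys|y /= ys|c c0 hc] := @compact_pos_lb R _ _ (fun y => w y x)
  (@sphere_compact _ _ x r').
- by apply: cw; rewrite ys.
- rewrite lt_def rad2_ge0 andbT; apply/eqP => w0.
  have yx : y = x by apply: winj => //; rewrite ys.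
  by move: r'0; rewrite -ys yx subrr normr0 ltxx.
have wxx : w x x = 0 by rewrite /w subrr /rad2 !dot0r mulr0 addr0.
have near1 : \forall y \near x, `|x - y| < r' /\ w y x < c / 4.
  apply: filterI.
    by apply: (cvgr_lt _ (@dist_continuous _ _ x x)); rewrite subrr normr0.
  by apply: (cvgr_lt _ (cw x x xx)); rewrite wxx divr_gt0.
apply: filterS near1 => q [qr qc]; apply/eqP/negP => /negP/eqP qm.
have cZ : compact (cball x r' `&` [set y | dot v3 (X y) <= m]).
  apply: sublevel_compact; [exact: norm_hausdorff|exact: cball_compact|] => y yB.
  by apply: param_comp_continuous; [exact: dot_continuous|exact/BU/inB].
have [||y0 y0Z miny0] := @compact_EVT_min _ _ (fun y => w y q) _ _ cZ.
- by exists x; split; rewrite /cball /= ?subrr ?normr0 ?xm // ltW.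
- apply: continuous_in_subspaceT => y; rewrite inE => -[yB _].
  exact/cw/inB.
move: y0Z; rewrite inE => -[y0B y0m].
have y0r := inB _ y0B.
have {}y0m : dot v3 (X y0) = m by apply/eqP; rewrite eq_le y0m mX //; exact: BU.
have y0x : w y0 q <= w x q.
  by apply: miny0; rewrite inE; split; rewrite /cball /= ?subrr ?normr0 ?xm // ltW.
have y0s : `|x - y0| < r'.
  rewrite lt_neqAle y0B andbT; apply/eqP => ys.
  have := hc y0 ys; have := wD y0 q x; move: y0x qc; rewrite (wC x q); lra.
have qr' : `|x - q| < r by exact: lt_trans r'r.
have w0 : 0 < rad2 v1 v2 (X q - X y0).
  rewrite lt_def rad2_ge0 andbT; apply/eqP => w0; apply: qm.
  by rewrite (winj q y0 qr' y0r w0).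
pose s := r' - `|x - y0|.
have s0 : 0 < s by rewrite subr_gt0.
have sB y : `|y0 - y| <= s -> `|x - y| <= r'.
  move=> ys; rewrite -(subrKA y0) (le_trans (ler_normD _ _)) //.
  by move: ys; rewrite /s; lra.
apply: (no_interior_contact s0 (BU _ qr') _ y0m w0) => y ys.
- exact/BU/inB/sB.
- by apply: winj => //; exact/inB/sB.
- move=> ym; rewrite -/(w q y0) -/(w q y) wC (wC q y).
  by apply: miny0; rewrite inE; split; [exact: sB|rewrite /= ym].
Qed.

End StrongMaximumPrinciple.

(** * Surfaces of constant height *)

Section Flatness.
Context {R : realType}.
Variables (X : 'rV[R]_2 -> 'rV[R]_3) (U : set 'rV[R]_2).
Hypotheses (oU : open U) (sX : smooth_on U X).
Hypothesis injX : forall y, U y -> injective ('d X y).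
Variables (v : 'rV[R]_3) (m : R).
Hypothesis vv : dot v v = 1.
Hypothesis mX : forall y, U y -> dot v (X y) = m.

Lemma planar_partial i y : U y -> dot v (partial i X y) = 0.
Proof.
move=> Uy; have dX : differentiable X y by exact: (sX [::]).
have [_ dE] := is_derive_dot v (derivableP (@diff_derivable _ _ _ _ _ (delta_mx 0 i) dX)).
have nU : \forall z \near y, U z by exact: open_nbhs_nbhs.
rewrite -[LHS]dE (@near_eq_derive _ _ _ _ (cst m)) ?derive_cst //.
by apply: filterS nU => z /mX.
Qed.

Lemma planar_partial2 i j y : U y -> dot v (partial j (partial i X) y) = 0.
Proof.
move=> Uy; have dX : differentiable (partial i X) y by exact: (sX [:: i]).
have [_ dE] := is_derive_dot v (derivableP (@diff_derivable _ _ _ _ _ (delta_mx 0 j) dX)).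
have nU : \forall z \near y, U z by exact: open_nbhs_nbhs.
rewrite -[LHS]dE (@near_eq_derive _ _ _ _ (cst 0)) ?derive_cst //.
by apply: filterS nU => z; exact: planar_partial.
Qed.

(** The unit normal is a multiple of the constant vector [v], and all second
    derivatives of [X] are orthogonal to [v]. *)
Lemma planar_gauss_curvature y : U y -> gauss_curvature X y = 0.
Proof.
move=> Uy; have dX : differentiable X y by exact: (sX [::]).
have ind := immersion_independent dX (injX Uy).
have [nn n0 n1] := dot_unit_normal dX (injX Uy).
suff S0 : second_form X y = 0.
  by rewrite /gauss_curvature /shape_operator S0 mulmx0 det0.
apply/matrixP => i j; rewrite !mxE.
apply: (dot_common_normal ind nn n0 n1 vv); try exact: planar_partial.
by rewrite dotC planar_partial2.
Qed.

End Flatness.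

Theorem theorem2 (R : realType) (M : smooth_surface R) (f : M -> 'rV[R]_3) :
  connected [set: M] ->
  minimal_immersion f ->
  geodesically_complete f ->
  proper_immersion f ->
  ~ flat_surface f ->
  forall H : set 'rV[R]_3, halfspace H -> ~ (range f `<=` H).
Proof.
move=> conM mf _ pf nflat H [v [b [v0 HE]]] fH; apply: nflat.
have bf p : b <= dot v (f p).
  have : H (f p) by apply: fH; exists p.
  by case: HE => -> //= /ltW.
have nv0 := dot_gt0 v0; have sv0 : 0 < Num.sqrt (dot v v) by rewrite sqrtr_gt0.
pose v3 := (Num.sqrt (dot v v))^-1 *: v.
have v33 : dot v3 v3 = 1.
  by rewrite dotZl dotZr mulrA -invfM -expr2 sqr_sqrtr ?ltW // mulVf // gt_eqF.
have [v1 [v2 vO]] := complete_frame v33.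
move=> c ac x cx; have [p cp _] := cx.
have [q|p0 minp0] := height_min_attained (b := b / Num.sqrt (dot v v)) vO p mf pf.
  by rewrite dotZl mulrC ler_pM2l // invr_gt0.
have [sf H0] := mf; have cf := smooth_immersion_continuous sf.
pose Z := [set q | dot v3 (f q) = dot v3 (f p0)].
have mX c' y : chart_codom c' y -> dot v3 (f p0) <= dot v3 (local_param f c' y).
  by move=> _; exact: minp0.
have chf : continuous (fun q => dot v3 (f q)).
  by move=> q; apply: (@continuous_comp _ _ _ f (dot v3)); [exact: cf|exact: dot_continuous].
have oZ : open Z.
  rewrite openE => z zZ; have [c' ac' cz] := atlas_cover z.
  have cx' : chart_codom c' (chart_map c' z) by exists z.
  have [sX inj] := sf c' ac'.
  have nZ := lowest_points_open (@chart_codom_open _ _ c') sX inj (H0 _ ac') vO (mX c') cx'.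
  rewrite local_paramK // in nZ.
  have {}nZ : \forall q \near z,
      dot v3 (local_param f c' (chart_map c' q)) = dot v3 (f p0).
    exact: (chart_map_continuous cz (nZ zZ)).
  have nD : \forall q \near z, chart_dom c' q.
    exact: (open_nbhs_nbhs (conj (@chart_dom_open _ _ c') cz)).
  have : \forall q \near z, Z q; last by [].
  by apply: filterS2 nZ nD => q /= + cq; rewrite local_paramK.
have cZ : closed Z.
  have -> : Z = (fun q => dot v3 (f q)) @^-1` [set dot v3 (f p0)] by [].
  by apply: closed_comp; [move=> *; exact: chf|exact: closed_eq].
have ZT : Z = [set: M].
  by apply: conM; [exists p0|exists Z; rewrite ?setTI|exists Z; rewrite ?setTI].
have [sX inj] := sf c ac.
apply: (planar_gauss_curvature (@chart_codom_open _ _ c) sX inj v33 (m := dot v3 (f p0))) => //.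
move=> y _; have : Z (chart_inv c y) by rewrite ZT.
by [].
Qed.
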